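(* For every $n,d\in\mathbb N$ and every $g\in\mathcal U_n$, $$\mathbf k_{\mathcal P_d(\mathcal U_n)}(I,g)=\sum_{\mu\vdash d}\frac{n^{\ell(\mu)}}{z_\mu}\prod_{j=1}^{\ell(\mu)}\operatorname{tr}\bigl(g^{\mu_j}\bigr).$$ Equivalently, $$\mathbf k_{\mathcal P_d(\mathcal U_n)}(I,g)=\sum_{\substack{\lambda\vdash d\\\ell(\lambda)\le n}}\dim S_\lambda(\mathbb C^n)\,\chi_{S_\lambda(\mathbb C^n)}(g)=\sum_{\substack{\lambda\vdash d\\\ell(\lambda)\le n}}s_\lambda(1^n)\,s_\lambda(\operatorname{eigs}(g)).$$
   Context: Complex scalars. $\mathcal U_n$ is the unitary group of $\mathbb C^n$ with normalized Haar measure, $I$ the identity matrix. $\mathcal P_d(\mathcal U_n)\subset C(\mathcal U_n)$ is the space of restrictions to $\mathcal U_n$ of complex $d$-homogeneous (holomorphic) polynomials on the space of complex $n\times n$ matrices. Its reproducing kernel is $\mathbf k_{\mathcal P_d(\mathcal U_n)}(x,y)=\sum_j\overline{f_j(x)}f_j(y)$ for any orthonormal basis $(f_j)$ of $\mathcal P_d(\mathcal U_n)$ in $L_2(\mathcal U_n)$. A partition $\mu\vdash d$ is a non-increasing sequence $\mu_1\ge\mu_2\ge\cdots$ of non-negative integers with sum $d$; $\ell(\mu)$ is its number of non-zero parts; $m_r(\mu)$ is the number of parts equal to $r$; $z_\mu=\prod_{r\ge1}r^{m_r(\mu)}m_r(\mu)!$. For $\ell(\lambda)\le n$, the Schur polynomial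 is $s_\lambda(x_1,\ldots,x_n)=\det(x_i^{\lambda_j+n-j})_{i,j}/\det(x_i^{n-j})_{i,j}$ (extended to a polynomial), $1^n=(1,\ldots,1)$, $\operatorname{eigs}(g)$ is the tuple of eigenvalues of $g$, and $S_\lambda(\mathbb C^n)$ is the carrier space of the irreducible unitary representation of $\mathcal U_n$ (unique up to equivalence) whose character $\chi_{S_\lambda(\mathbb C^n)}$ is $g\mapsto s_\lambda(\operatorname{eigs}(g))$. *)

(* Defs.v *)
From HB Require Import structures.
From mathcomp Require Import all_boot all_order all_algebra.
From mathcomp Require Import all_classical all_reals all_analysis.
From mathcomp Require Import complex.
From mathcomp Require mpoly.
(* The notations of mpoly clash with those of mathcomp-analysis. *)
Import (canonicals, coercions) mpoly.

Set Implicit Arguments.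
Unset Strict Implicit.
Unset Printing Implicit Defensive.

Import Order.TTheory GRing.Theory Num.Theory.
Import numFieldNormedType.Exports.

Local Open Scope classical_set_scope.
Local Open Scope ring_scope.
Local Open Scope complex_scope.
Local Open Scope sesquilinear_scope.

(* The usual topology of the complex numbers, given by the modulus; matrices
   then carry the product topology. *)
HB.instance Definition _ (R : realType) :=
  PseudoPointedMetric.copy R[i] R[i]^o.

Definition unitary_group (R : realType) (n : nat) :=
  set_type [set M : 'M[R[i]]_n | M \is unitarymx].

Section UnitaryGroup.
Context (R : realType) (n : nat).
Local Notation U := (unitary_group R n).

(* Subspace topology inherited from the matrices. *)
HB.instance Definition _ := Topological.on U.

Definition mxU (g : U) : 'M[R[i]]_n := set_val g.

Lemma mxU_unitary (g : U) : mxU g \is unitarymx.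
Proof. exact: (set_mem (valP g)). Qed.

Definition mkU (M : 'M[R[i]]_n) (hM : M \is unitarymx) : U :=
  exist _ M (mem_set hM).

Lemma mxU_inj : injective mxU.
Proof. exact: val_inj. Qed.

Lemma unitarymx1 : (1%:M : 'M[R[i]]_n) \is unitarymx.
Proof. by apply/unitarymxP; rewrite trmx1 map_mx1 mulmx1. Qed.

Definition oneU : U := mkU unitarymx1.
Definition mulU (g h : U) : U :=
  mkU (mul_unitarymx (mxU_unitary g) (mxU_unitary h)).
Definition invU (g : U) : U :=
  mkU (etrans (trmxC_unitary (mxU g)) (mxU_unitary g)).

Lemma mulUA : associative mulU.
Proof. by move=> x y z; apply: mxU_inj; exact: mulmxA. Qed.
Lemma mul1U : left_id oneU mulU.
Proof. by move=> x; apply: mxU_inj; exact: mul1mx. Qed.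
Lemma mulU1 : right_id oneU mulU.
Proof. by move=> x; apply: mxU_inj; exact: mulmx1. Qed.
Lemma mulUV : right_inverse oneU invU mulU.
Proof. by move=> x; apply: mxU_inj; exact: (unitarymxP (mxU_unitary x)). Qed.
Lemma mulVU : left_inverse oneU invU mulU.
Proof. by move=> x; apply: mxU_inj; apply: mulmx1C; exact: (congr1 mxU (mulUV x)). Qed.

HB.instance Definition _ := isPointed.Build U oneU.
HB.instance Definition _ := isGroup.Build U mulUA mul1U mulU1 mulVU mulUV.

End UnitaryGroup.

Definition borelU (R : realType) (n : nat) :=
  g_sigma_algebraType (@open (unitary_group R n)).

Definition is_haar (R : realType) (n : nat) (mu : probability (borelU R n) R) :=
  forall (g : unitary_group R n) (A : set (borelU R n)), measurable A ->
    mu [set (g * h)%g | h in A] = mu A.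

Section Kernel.
Context (R : realType) (n : nat).
Local Notation U := (unitary_group R n).

(* Linear in the first argument, as in L_2(U_n). *)
Definition inner_prod (mu : probability (borelU R n) R) (f h : U -> R[i]) : R[i] :=
  let F x := f x * (h x)^* in
  Rintegral mu setT (fun x => complex.Re (F x)) +i*
  Rintegral mu setT (fun x => complex.Im (F x)).

(* The n * n matrix entries are the variables, enumerated by [mxvec]. *)
Definition homog_poly (d : nat) : set (U -> R[i]) :=
  [set f | exists2 p : mpoly.mpoly (n * n) R[i],
     p \is mpoly.ishomog1 d mpoly.mdeg &
     forall x, f x = mpoly.meval (fun k => mxvec (mxU x) 0 k) p].

Definition orthonormal_basis (mu : probability (borelU R n) R)
    (V : set (U -> R[i])) (N : nat) (f : 'I_N -> U -> R[i]) :=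
  [/\ forall j, V (f j),
      forall i j, inner_prod mu (f i) (f j) = (i == j)%:R &
      forall h, V h -> exists c : 'I_N -> R[i],
        forall x, h x = \sum_(j < N) c j * f j x].

Definition repr_kernel (N : nat) (f : 'I_N -> U -> R[i]) (x y : U) : R[i] :=
  \sum_(j < N) (f j x)^* * f j y.

End Kernel.

(* Since a partition of d has at most d non-zero parts, each at most d, it is
   recorded by its first d terms; all further terms are 0. *)
Definition intpart (d : nat) :=
  {t : d.-tuple 'I_d.+1 | sorted geq [seq val i | i <- t] &&
                          (sumn [seq val i | i <- t] == d)}.

Section Partitions.
Context (d : nat) (mu : intpart d).

Definition parts : seq nat := [seq val i | i <- val mu].

Definition part (j : nat) : nat := nth 0%N parts j.

Definition plength : nat := count (fun k => 0 < k)%N parts.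

Definition pmult (r : nat) : nat := count_mem r parts.

(* No part exceeds d, so the factors with r > d are 1. *)
Definition zpart : nat := (\prod_(1 <= r < d.+1) (r ^ pmult r * (pmult r)`!))%N.

End Partitions.

Section Schur.
Context (R : realType) (n : nat).
Local Notation Xvar i := (mpoly.mpolyX R[i] (mpoly.mnm1 i)).

(* The columns are indexed from 0, so the exponent n - j reads n - j.+1. *)
Definition alternant (e : nat -> nat) : mpoly.mpoly n R[i] :=
  \det (\matrix_(i < n, j < n) Xvar i ^+ (e j + (n - j.+1))%N).

(* The quotient of two alternants as a polynomial; it is unique because the
   Vandermonde determinant [alternant (fun=> 0)] is non-zero. *)
Definition schur (d : nat) (lam : intpart d) : mpoly.mpoly n R[i] :=
  xget 0 [set s | s * alternant (fun=> 0%N) = alternant (part lam)].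

Definition schur_eval (d : nat) (lam : intpart d) (x : 'I_n -> R[i]) : R[i] :=
  mpoly.meval x (schur lam).

(* The n roots of the characteristic polynomial, with multiplicity. *)
Definition eigs (M : 'M[R[i]]_n) (i : 'I_n) : R[i] :=
  (sval (closed_field_poly_normal (char_poly M)))`_i.

End Schur.

(* An irreducible unitary representation on C^rep_dim, i.e. on a
   finite-dimensional Hilbert space with a chosen orthonormal basis.
   Representing matrices act on columns; subspaces are row spaces in MathComp,
   whence the transposition in [rep_irr]. *)
Record irr_unitary_rep (R : realType) (n : nat) := IrrUnitaryRep {
  rep_dim : nat;
  rep_mx :> unitary_group R n -> 'M[R[i]]_rep_dim;
  rep_continuous : continuous rep_mx;
  rep_unitary : forall g, rep_mx g \is unitarymx;
  rep_one : rep_mx 1%g = 1%:M;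
  rep_mul : forall g h, rep_mx (g * h)%g = rep_mx g *m rep_mx h;
  rep_dim_gt0 : (0 < rep_dim)%N;
  rep_irr : forall W : 'M[R[i]]_rep_dim,
    (forall g, stablemx W (rep_mx g)^T) -> W = 0 \/ row_full W
}.

Definition rep_char (R : realType) (n : nat) (S : irr_unitary_rep R n)
  (g : unitary_group R n) : R[i] := \tr (S g).

(* Main.v *)
Require Import Defs.
From HB Require Import structures.
From mathcomp Require Import all_boot all_order all_algebra.
From mathcomp Require Import all_classical all_reals all_analysis.
From mathcomp Require Import complex ring zify perm.
From mathcomp Require mpoly.
Import (canonicals, coercions) mpoly.
Import Order.TTheory GRing.Theory Num.Theory.
Import numFieldNormedType.Exports.
Local Open Scope ring_scope.
Local Open Scope complex_scope.
Set Implicit Arguments.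
Unset Strict Implicit.
Unset Printing Implicit Defensive.

(**
In the power sums of the eigenvalues the asserted kernel is
[K_d = sum_mu n^l(mu) p_mu / z_mu], characterised by [K_0 = 1] and
[d K_d = sum_(1 <= k <= d) n p_k K_(d-k)].

Reproducing property.  Let [D_X] be the derivation of functions of [g] along
[g |-> (1 + s X) g].  Haar measure integrates [D_X F] to 0 when [F] is a
polynomial in the entries of [g] and [w = g^-1].  For [h] homogeneous of degree
[d], the sum over [i, j] of [D_(E_ij) (h (delta_ij K_d(w) - w_ij K_(d-1)(w)))]
is [d h K_d(w) - (sum_a d h / d g_aa) K_(d-1)(w)].  Hence, by induction on [d]
and Euler's identity at the identity matrix, [h] integrated against
[K_d(w) = conj (K_d(g))] gives [h(1)].

Schur polynomials.  In the Newton basis [prod_(l < k) (t - x_l)] the powers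
[t^m] have complete homogeneous coefficients; this factors every alternant
through the Vandermonde determinant and gives
[s_lambda(1^n) = det C(lambda_i + n - i, n - j)].  The generating function
of the [K_d] is [prod_i (1 - x_i t)^-n]; multiplying it by the Vandermonde determinant
and collecting equal exponents yields [sum_lambda s_lambda(1^n) a_(lambda+delta)].
*)

(** * Integration against Haar measure *)

Section HaarIntegral.
Variables (R : realType) (n : nat).
Local Notation U := (unitary_group R n).
Local Notation C := R[i].

Lemma mxU_continuous : continuous (@mxU R n).
Proof. exact: initial_continuous. Qed.

Lemma entry_continuous i j : continuous (fun g : U => mxU g i j : C).
Proof.
move=> g; apply: (@continuous_comp _ _ _ (@mxU R n) (fun M : 'M[C]_n => M i j)).
  exact: mxU_continuous.
exact: coord_continuous.
Qed.

Lemma Re_continuous : continuous (@complex.Re R : C -> R).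
Proof.
move=> z.
apply: (proj2 (@cvgrPdist_lt _ _ C (nbhs z) (nbhs_filter z) (@complex.Re R) (complex.Re z))) => e e0.
have zz : (t @[t --> z] --> z)%classic by [].
have /(_ e%:C) := proj1 (@cvgrPdist_lt _ C^o C (nbhs z) (nbhs_filter z) id z) zz.
rewrite ltcR => /(_ e0); apply: filterS => t /(le_lt_trans (normc_ge_Re _)).
by rewrite ltcR raddfB.
Qed.

Lemma Im_continuous : continuous (@complex.Im R : C -> R).
Proof.
move=> z.
have -> : (@complex.Im R : C -> R) = @complex.Re R \o ( *%R (- 'i%C)).
  by apply: funext => -[a b] /=; rewrite oppr0 mul0r mulN1r sub0r opprK.
apply: (@continuous_comp C C R ( *%R (- 'i%C)) (@complex.Re R)).
  exact: (@mulrl_continuous C).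
exact: Re_continuous.
Qed.

(** The topology of the group is initial for [mxU], so continuity can be tested on matrix entries.
    Each entry of a product with a fixed left factor is a linear form in the entries of the right
    factor. *)
Lemma mulU_continuous (u : U) : continuous (@mulU R n u).
Proof.
apply: continuous_comp_initial => g A /=.
move=> [P hP sP].
have H i j : nbhs g [set h | P i j ((mxU u *m mxU h) i j)]%classic.
  have : continuous (fun h : U => (mxU u *m mxU h) i j : C).
    have sum_cont (s : seq 'I_n) :
        continuous (fun h : U => \sum_(k <- s) mxU u i k * mxU h k j : C).
      elim: s => [|k s IHs] h.
        by under eq_fun do rewrite big_nil; exact: cst_continuous.
      under eq_fun do rewrite big_cons.
      rewrite /continuous_at.
      apply: (@cvgD C C^o _ (nbhs h) (nbhs_filter h) (fun h : U => mxU u i k * mxU h k j)); last exact: IHs.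
      apply: (@continuous_comp _ _ _ (fun h : U => mxU h k j) ( *%R (mxU u i k))).
        exact: entry_continuous.
      exact: (@mulrl_continuous C).
    rewrite (_ : (fun h : U => _) = fun h : U => \sum_k mxU u i k * mxU h k j) //.
    by apply/funext => h; rewrite mxE.
  move/(_ g (P i j)); apply; exact: hP.
have H1 i := filter_forall (nbhs_filter g) (H i).
have := filter_forall (nbhs_filter g) H1.
apply: filterS => h hh; exact: sP.
Qed.

Local Notation Re := (@complex.Re R).
Local Notation Im := (@complex.Im R).

(** Bounded Borel functions form an algebra stable under conjugation and are integrable for any
    probability. Membership in this class replaces separate integrability arguments. *)
Definition bmfun (F : borelU R n -> C) :=
  [/\ measurable_fun setT (Re \o F), measurable_fun setT (Im \o F) &
      exists B : R, forall x, `|Re (F x)| <= B /\ `|Im (F x)| <= B].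

Lemma continuous_measurable_borelU (f : U -> R) : continuous f ->
  measurable_fun (setT : set (borelU R n)) f.
Proof.
move=> cf; apply: (measurability _ (measurable_realfun.RGenOpens.measurableE R)).
move=> _ [_ [x [y ->]] <-]; rewrite setTI; apply: sub_sigma_algebra.
by move/continuousP: cf; apply; exact: interval_open.
Qed.

Lemma bmfun_cst c : bmfun (fun=> c).
Proof.
split; try exact: measurable_cst.
exists (Num.max `|Re c| `|Im c|) => x.
by rewrite !le_max !lexx orbT.
Qed.

Lemma bmfun_add F G : bmfun F -> bmfun G -> bmfun (fun x => F x + G x).
Proof.
move=> [rF iF [B hB]] [rG iG [B' hB']]; split.
- rewrite (_ : _ \o _ = (Re \o F) \+ (Re \o G)); last by apply/funext => x /=; rewrite raddfD.
  exact: measurable_realfun.measurable_funD.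
- rewrite (_ : _ \o _ = (Im \o F) \+ (Im \o G)); last by apply/funext => x /=; rewrite raddfD.
  exact: measurable_realfun.measurable_funD.
exists (B + B') => x; rewrite !raddfD /=.
have [? ?] := hB x; have [? ?] := hB' x.
by split; apply: (le_trans (ler_normD _ _)); apply: lerD.
Qed.

Lemma bmfun_mul F G : bmfun F -> bmfun G -> bmfun (fun x => F x * G x).
Proof.
move=> [rF iF [B hB]] [rG iG [B' hB']]; split.
- rewrite (_ : _ \o _ = ((Re \o F) \* (Re \o G)) \- ((Im \o F) \* (Im \o G)));
    last by apply/funext => x /=; case: (F x) (G x) => ? ? [? ?].
  by apply: measurable_realfun.measurable_funB; apply: measurable_realfun.measurable_funM.
- rewrite (_ : _ \o _ = ((Re \o F) \* (Im \o G)) \+ ((Im \o F) \* (Re \o G)));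
    last by apply/funext => x /=; case: (F x) (G x) => ? ? [? ?].
  by apply: measurable_realfun.measurable_funD; apply: measurable_realfun.measurable_funM.
exists (B * B' + B * B') => x.
move: (hB x) (hB' x); case: (F x) (G x) => a b [c e] /= [? ?] [? ?].
by split; [apply: (le_trans (ler_normB _ _))|apply: (le_trans (ler_normD _ _))];
  apply: lerD; rewrite normrM; apply: ler_pM.
Qed.

Lemma bmfun_conj F : bmfun F -> bmfun (fun x => (F x)^*).
Proof.
move=> [rF iF [B hB]]; split.
- by rewrite (_ : _ \o _ = Re \o F) //; apply/funext => x /=; case: (F x).
- rewrite (_ : _ \o _ = \- (Im \o F)); first exact: measurable_realfun.measurable_funN.
  by apply/funext => x /=; case: (F x).
exists B => x; have := hB x; case: (F x) => a b /=; by rewrite normrN.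
Qed.

(** The rows of a unitary matrix are unit vectors. *)
Lemma entry_le1 (g : U) i j : `|mxU g i j| <= 1.
Proof.
have /unitarymxP /matrixP /(_ i i) := mxU_unitary g.
rewrite !mxE eqxx mulr1n (bigD1 j) //= !mxE => H.
rewrite -(@ler_pXn2r _ 2) ?nnegrE // normCK expr1n -H lerDl sumr_ge0 // => k _.
by rewrite !mxE mul_conjC_ge0.
Qed.

Lemma bmfun_entry i j : bmfun (fun g => mxU g i j).
Proof.
split.
- apply: continuous_measurable_borelU => g; apply: continuous_comp; first exact: entry_continuous.
  exact: Re_continuous.
- apply: continuous_measurable_borelU => g; apply: continuous_comp; first exact: entry_continuous.
  exact: Im_continuous.
exists 1 => g; have := entry_le1 g i j => h; split; rewrite -lecR.
  exact: (le_trans (normc_ge_Re _)).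
have -> : Im (mxU g i j) = Re (- 'i%C * mxU g i j).
  by case: (mxU g i j) => a b /=; rewrite oppr0 mul0r mulN1r sub0r opprK.
by apply: (le_trans (normc_ge_Re _)); rewrite normrM normrN normCi mul1r.
Qed.

Lemma bmfun_sum (I : Type) (s : seq I) (P : pred I) (F : I -> borelU R n -> C) :
  (forall i, bmfun (F i)) -> bmfun (fun x => \sum_(i <- s | P i) F i x).
Proof.
move=> rF; elim: s => [|i s IHs].
  have -> : (fun x => \sum_(i <- [::] | P i) F i x) = fun=> 0.
    by apply/funext => x; exact: big_nil.
  exact: bmfun_cst.
have -> : (fun x => \sum_(i <- i :: s | P i) F i x) =
   fun x => (if P i then F i x else 0) + \sum_(i <- s | P i) F i x.
  by apply/funext => x; rewrite big_cons; case: ifP; rewrite ?add0r.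
by apply: bmfun_add => //; case: (P i); [exact: rF|exact: bmfun_cst].
Qed.

Variable mu : probability (borelU R n) R.

Lemma integrable_Re_bmfun F : bmfun F -> mu.-integrable setT (EFin \o (Re \o F)).
Proof.
move=> [rF _ [B hB]]; apply: measurable_bounded_integrable => //.
  by rewrite [X in (X < _)%E](probability_setT mu) ltry.
exists B; split; first exact: num_real.
move=> x Bx y _ /=; apply: (le_trans _ (ltW Bx)); exact: (proj1 (hB y)).
Qed.

Lemma integrable_Im_bmfun F : bmfun F -> mu.-integrable setT (EFin \o (Im \o F)).
Proof.
move=> [_ rF [B hB]]; apply: measurable_bounded_integrable => //.
  by rewrite [X in (X < _)%E](probability_setT mu) ltry.
exists B; split; first exact: num_real.
move=> x Bx y _ /=; apply: (le_trans _ (ltW Bx)); exact: (proj2 (hB y)).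
Qed.

(** Shaped like [inner_prod], so that the two are convertible ([inner_prodE]). *)
Definition cint (F : borelU R n -> C) : C :=
  Rintegral mu setT (Re \o F) +i* Rintegral mu setT (Im \o F).

Lemma cint_ext F G : F =1 G -> cint F = cint G.
Proof. by move=> /funext ->. Qed.

Lemma cintD F G : bmfun F -> bmfun G -> cint (fun x => F x + G x) = cint F + cint G.
Proof.
move=> rF rG; rewrite /cint.
have -> : Re \o (fun x => F x + G x) = fun x => (Re \o F) x + (Re \o G) x.
  by apply/funext => x /=; rewrite raddfD.
have -> : Im \o (fun x => F x + G x) = fun x => (Im \o F) x + (Im \o G) x.
  by apply/funext => x /=; rewrite raddfD.
rewrite !RintegralD //; try exact: integrable_Re_bmfun; exact: integrable_Im_bmfun.
Qed.

Lemma cintZ c F : bmfun F -> cint (fun x => c * F x) = c * cint F.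
Proof.
case: c => a b rF; rewrite /cint.
have rl := integrable_Re_bmfun rF; have ri := integrable_Im_bmfun rF.
have cr r (f : borelU R n -> R) : mu.-integrable setT (EFin \o f) ->
    mu.-integrable setT (EFin \o (fun x => r * f x)).
  by move=> h; apply: (eq_integrable _ _ _ _ (integrableZl _ _ h)) => // r.
have -> : Re \o (fun x => (a +i* b) * F x) = fun x => a * (Re \o F) x - b * (Im \o F) x.
  by apply/funext => x /=; case: (F x).
have -> : Im \o (fun x => (a +i* b) * F x) = fun x => a * (Im \o F) x + b * (Re \o F) x.
  by apply/funext => x /=; case: (F x).
rewrite RintegralB ?RintegralD ?RintegralZl //; exact: cr.
Qed.

Lemma cint_cst c : cint (fun=> c) = c.
Proof.
case: c => a b; rewrite /cint /comp /= !Rintegral_cst //.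
by congr (_ +i* _); rewrite [X in _ * fine X](probability_setT mu) mulr1.
Qed.

Lemma cint_sum (I : Type) (s : seq I) (P : pred I) (F : I -> borelU R n -> C) :
  (forall i, bmfun (F i)) ->
  cint (fun x => \sum_(i <- s | P i) F i x) = \sum_(i <- s | P i) cint (F i).
Proof.
move=> rF; elim: s => [|i s IHs].
  by rewrite big_nil -[RHS](cint_cst 0); apply: cint_ext => x; rewrite big_nil.
rewrite big_cons; case: ifPn => Pi.
  rewrite -IHs -cintD //; last exact: bmfun_sum.
  by apply: cint_ext => x; rewrite big_cons Pi.
by rewrite -IHs; apply: cint_ext => x; rewrite big_cons (negbTE Pi).
Qed.

Hypothesis haarP : is_haar mu.

Lemma measurable_mulU (u : U) : measurable_fun setT (fun g : borelU R n => mulU u g : borelU R n).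
Proof.
apply: (@measurability _ _ (borelU R n) (borelU R n) setT (mulU u) (@open U)) => //.
move=> _ [A oA <-]; rewrite setTI; apply: sub_sigma_algebra.
by move/continuousP: (@mulU_continuous u); apply.
Qed.

(** [is_haar] speaks of images under translations; the preimage of [A] under translation by [u] is
    its image under translation by the inverse of [u]. *)
Lemma pushforward_mulU (u : U) A : measurable A ->
  pushforward mu (mulU u : borelU R n -> borelU R n) A = mu A.
Proof.
move=> mA; rewrite /pushforward -(haarP (invU u) mA); congr (mu _).
apply/seteqP; split => [g /= Ag|g [h Ah <-]] /=.
  by exists (mulU u g) => //; rewrite -[LHS]/(mulU (invU u) (mulU u g)) mulUA mulVU mul1U.
by rewrite -[X in A X]/(mulU u (mulU (invU u) h)) mulUA mulUV mul1U.
Qed.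

Lemma bmfun_mulU F u : bmfun F -> bmfun (fun g => F (mulU u g)).
Proof.
move=> [rF iF [B hB]]; split; last by exists B => x.
- exact: (measurableT_comp rF (measurable_mulU u)).
- exact: (measurableT_comp iF (measurable_mulU u)).
Qed.

Lemma Rintegral_mulU (f : borelU R n -> R) u : mu.-integrable setT (EFin \o f) ->
  mu.-integrable setT (EFin \o (fun g => f (mulU u g))) ->
  Rintegral mu setT (fun g => f (mulU u g)) = Rintegral mu setT f.
Proof.
move=> fi fu; rewrite /Rintegral; congr fine.
case/integrableP: (fi) => mf _.
have mu_u := measurable_mulU u.
have := @integral_pushforward _ _ (borelU R n) (borelU R n) R _ mu_u mu setT (EFin \o f) mf fu measurableT.
rewrite preimage_setT => <-.
(* Bundling the translation with its measurability makes the pushforward a measure, which is then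
   compared with [mu] set by set. *)
pose phi : {mfun borelU R n >-> borelU R n} := HB.pack (fun g : borelU R n => mulU u g : borelU R n)
   (isMeasurableFun.Build _ _ _ _ _ mu_u).
apply: (@eq_measure_integral _ _ _ _ mu (pushforward mu phi)) => A mA _.
exact: (pushforward_mulU u mA).
Qed.

Lemma cint_mulU F u : bmfun F -> cint (fun g => F (mulU u g)) = cint F.
Proof.
move=> rF; have rFu := bmfun_mulU u rF.
rewrite /cint; congr (_ +i* _); apply: Rintegral_mulU.
- exact: integrable_Re_bmfun.
- exact: (integrable_Re_bmfun rFu).
- exact: integrable_Im_bmfun.
- exact: (integrable_Im_bmfun rFu).
Qed.
End HaarIntegral.

(** * Derivatives along left translations *)

Section LeftDerivative.
Variables (R : realType) (n : nat).
Local Notation U := (unitary_group R n).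
Local Notation C := R[i].

(* With [c k = k - M] the left-hand side is the derivative at 1 of ['X^-M * p].
   Expressing it by values on the unit circle avoids differentiating under the
   integral sign. *)
Lemma unit_interp (N : nat) (c : nat -> C) :
  exists (z b : 'I_N -> C), (forall i, z i * (z i)^*%R = 1) /\
   forall p : {poly C}, (size p <= N)%N ->
     \sum_(k < N) p`_k * c k = \sum_i b i * p.[z i].
Proof.
(* The nodes [z] are the Cayley transforms (1 + ik)/(1 - ik) of k = 0, 1, ...: distinct points of
   the unit circle. *)
pose y k : C := 1 - 'i * (k%:R).
pose z (i : 'I_N) := 2 / y i - 1.
have yJ k : (y k)^*%R = 1 + 'i * k%:R.
  by rewrite rmorphB rmorph1 rmorphM /= conjCi conjC_nat mulNr opprK.
have y0 k : y k != 0.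
  have y2 : y k + (y k)^*%R = 2 by rewrite yJ /y; ring.
  apply/eqP => yk0; move/eqP: y2.
  by rewrite yk0 rmorph0 addr0 eq_sym pnatr_eq0.
have yJ0 k : (y k)^*%R != 0 by rewrite conjC_eq0.
have zJ i : z i * (z i)^*%R = 1.
  rewrite /z rmorphB rmorph1 rmorphM fmorphV /= conjC_nat.
  have := y0 i; have := yJ0 i; rewrite yJ /y => h1 h2; field.
  by rewrite h1 h2.
have zinj : injective z.
  move=> i j; rewrite /z => /addIr /(mulfI _) => /(_ _) /invr_inj.
  rewrite pnatr_eq0 => /(_ isT) /subrI /mulfI; rewrite neq0Ci => /(_ isT) /eqP.
  by rewrite eqr_nat => /eqP /val_inj.
pose V := Vandermonde N (\row_i z i).
have Vu : V \in unitmx.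
  rewrite unitmxE det_Vandermonde unitfE; apply/prodf_neq0 => i _; apply/prodf_neq0 => j ij.
  by rewrite !mxE subr_eq0 (inj_eq zinj) eq_sym neq_ltn ij.
(* The weights solve the Vandermonde system saying that the formula is exact on the monomials of
   degree below [N]. *)
pose b := invmx V *m \col_(k < N) c k.
exists z, (fun i => b i 0); split=> // p sp.
have H (k : 'I_N) : c k = \sum_i z i ^+ k * b i 0.
  have /matrixP /(_ k 0) : V *m b = \col_(k < N) c k by rewrite mulKVmx.
  by rewrite !mxE => <-; apply: eq_bigr => i _; rewrite !mxE.
under eq_bigr do rewrite H mulr_sumr.
rewrite exchange_big /=; apply: eq_bigr => i _.
rewrite (horner_coef_wide _ sp) mulr_sumr; apply: eq_bigr => k _.
by rewrite mulrA mulrC.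
Qed.

Local Open Scope sesquilinear_scope.

(* Locked: unification would otherwise unfold [invU] and compare matrices entrywise. *)
Fact invmxU_key : unit. Proof. by []. Qed.
Definition invmxU (g : U) : 'M[C]_n := locked_with invmxU_key (mxU (invU g)).
Local Notation w := invmxU.

Lemma invmxUE g : w g = (mxU g)^t*.
Proof. by rewrite /w unlock. Qed.

Lemma invmxU_entry g i j : w g i j = (mxU g j i)^*%R.
Proof. by rewrite invmxUE !mxE. Qed.

Lemma mxU_mulU (u g : U) : mxU (mulU u g) = mxU u *m mxU g.
Proof. by []. Qed.

Lemma invmxUM (u g : U) : w (mulU u g) = w g *m w u.
Proof. by rewrite !invmxUE mxU_mulU trmx_mul map_mxM. Qed.

Lemma invmxU1 : w (oneU R n) = 1%:M.
Proof. by rewrite invmxUE -[mxU _]/(1%:M) trmx1 map_mx1. Qed.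

Lemma mul_invmxU g : w g *m mxU g = 1%:M.
Proof. by rewrite invmxUE; apply: mulmx1C; exact/unitarymxP/mxU_unitary. Qed.

(* [F' X g] is the derivative of [F] at [g] along [g |-> (1 + s X) g]. *)
Inductive lder : (U -> C) -> ('M[C]_n -> U -> C) -> Prop :=
| lder_cst c : lder (fun=> c) (fun _ _ => 0)
| lder_entry i j : lder (fun g => mxU g i j) (fun X g => (X *m mxU g) i j)
| lder_inv i j : lder (fun g => w g i j) (fun X g => - (w g *m X) i j)
| lder_add F F' G G' : lder F F' -> lder G G' ->
    lder (fun g => F g + G g) (fun X g => F' X g + G' X g)
| lder_mul F F' G G' : lder F F' -> lder G G' ->
    lder (fun g => F g * G g) (fun X g => F' X g * G g + F g * G' X g).

Lemma lder_ext F F' G G' : lder F F' -> F =1 G -> F' =2 G' -> lder G G'.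
Proof.
move=> dF /funext <- FG; rewrite (_ : G' = F') //.
by apply/funext => X; apply/funext => g; rewrite FG.
Qed.

Lemma bmfun_inv i j : bmfun (fun g : U => w g i j).
Proof.
have -> : (fun g : U => w g i j) = fun g => (mxU g j i)^*%R.
  by apply/funext => g; rewrite invmxU_entry.
exact/bmfun_conj/bmfun_entry.
Qed.

Lemma lder_bmfun F F' : lder F F' -> bmfun F /\ forall X, bmfun (F' X).
Proof.
elim=> {F F'} [c|i j|i j|F F' G G' _ [? h1] _ [? h2]|F F' G G' _ [? h1] _ [? h2]].
- by split=> [|X]; exact: bmfun_cst.
- split=> [|X]; first exact: bmfun_entry.
  under eq_fun do rewrite mxE.
  by apply: (bmfun_sum) => k; apply: bmfun_mul; [exact: bmfun_cst|exact: bmfun_entry].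
- split=> [|X]; first exact: bmfun_inv.
  under eq_fun do rewrite -mulN1r mxE.
  apply: bmfun_mul; first exact: bmfun_cst.
  by apply: (bmfun_sum) => k; apply: bmfun_mul; [exact: bmfun_inv|exact: bmfun_cst].
- by split=> [|X]; apply: bmfun_add.
- by split=> [|X]; [|apply: bmfun_add]; apply: bmfun_mul.
Qed.

(** Complex linearity in the direction extends results from Hermitian projections, which generate
    circles of unitary matrices, to all matrices. *)
Lemma lder_linear F F' : lder F F' -> forall a X Y g, F' (a *: X + Y) g = a * F' X g + F' Y g.
Proof.
elim=> {F F'} [c|i j|i j|F F' G G' _ h1 _ h2|F F' G G' _ h1 _ h2] a X Y g.
- by rewrite mulr0 addr0.
- by rewrite mulmxDl -scalemxAl !mxE.
- by rewrite mulmxDr -scalemxAr mxE [X in X + _]mxE opprD mulrN.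
- by rewrite h1 h2; ring.
- by rewrite h1 h2; ring.
Qed.

(* For a Hermitian idempotent [P] the matrices [1 + (z - 1) P], [|z| = 1], form a
   circle of unitary matrices, along which [F] is a Laurent polynomial in [z]. *)
Lemma lder_laurent (P : 'M[C]_n) : forall F F', lder F F' ->
  exists M N, forall g, exists p : {poly C},
   [/\ (size p <= N)%N,
       forall (z : C) (u : U), z * z^*%R = 1 ->
       mxU u = 1%:M + (z - 1) *: P ->
       w u = 1%:M + (z^*%R - 1) *: P ->
       z ^+ M * F (mulU u g) = p.[z] &
       F' P g = p^`().[1] - M%:R * p.[1]].
Proof.
move=> F F'; elim=> {F F'} [c|i j|i j|F F' G G' dF [M1 [N1 h1]] dG [M2 [N2 h2]]|F F' G G' dF [M1 [N1 h1]] dG [M2 [N2 h2]]].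
- exists 0%N, 1%N => g; exists c%:P; split.
  + exact: size_polyC_leq1.
  + by move=> z u zz _ _; rewrite hornerC expr0 mul1r.
  + by rewrite derivC horner0 mul0r subr0.
(* Here u g = g + (z - 1) P g is affine in [z]. *)
- exists 0%N, 2%N => g; exists ((mxU g i j - (P *m mxU g) i j)%:P + (P *m mxU g) i j *: 'X); split.
  + rewrite (leq_trans (size_polyD _ _)) // geq_max (leq_trans (size_polyC_leq1 _)) //.
    by rewrite (leq_trans (size_scale_leq _ _)) // size_polyX.
  + move=> z u zz hu _; rewrite expr0 mul1r mxU_mulU hu mulmxDl mul1mx -scalemxAl.
    by rewrite !hornerE !mxE; ring.
  + by rewrite derivD derivC derivZ derivX !hornerE subr0.
(* The inverse of u g is affine in the conjugate of [z], which is the inverse of [z]; one factor [z]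
   clears the denominator. *)
- exists 1%N, 2%N => g; exists (((w g *m P) i j)%:P + (w g i j - (w g *m P) i j) *: 'X); split.
  + rewrite (leq_trans (size_polyD _ _)) // geq_max (leq_trans (size_polyC_leq1 _)) //.
    by rewrite (leq_trans (size_scale_leq _ _)) // size_polyX.
  + move=> z u zz _; rewrite expr1; have := invmxUM u g.
    move: (w (mulU u g)) (w u) (w g) => wug wu A -> ->.
    rewrite mulmxDr mulmx1 -scalemxAr; move: (A *m P) => B; rewrite !hornerE 2!mxE.
    rewrite (_ : z * _ = z * A i j + (z * z^*%R - z) * B i j); last by ring.
    by rewrite zz; ring.
  + move: (w g *m P) => B; move: (w g) => A; rewrite derivD derivC derivZ derivX !hornerE /=.
    ring.
- exists (M1 + M2)%N, (N1 + M2.+1 + (N2 + M1.+1))%N => g.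
  have [p1 [s1 e1 f1]] := h1 g; have [p2 [s2 e2 f2]] := h2 g.
  (* Both Laurent polynomials are brought to the common denominator of exponent [M1 + M2]. *)
  exists (p1 * 'X^M2 + p2 * 'X^M1); split.
  + rewrite (leq_trans (size_polyD _ _)) // geq_max; apply/andP; split.
      rewrite (leq_trans (size_polyMleq _ _)) // size_polyXn.
      by rewrite (leq_trans (leq_pred _)) // (leq_trans _ (leq_addr _ _)) // leq_add2r.
    rewrite (leq_trans (size_polyMleq _ _)) // size_polyXn.
    by rewrite (leq_trans (leq_pred _)) // (leq_trans _ (leq_addl _ _)) // leq_add2r.
  + by move=> z u zz hu hw; rewrite !hornerE -(e1 z u) // -(e2 z u) // exprD; ring.
  + have dX k : (('X^k)^`()).[1] = k%:R :> C by rewrite derivXn hornerMn hornerXn expr1n.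
    rewrite f1 f2 derivD !derivM !hornerD !hornerM !dX !hornerXn !expr1n natrD; ring.
- exists (M1 + M2)%N, (N1 + N2)%N => g.
  have [p1 [s1 e1 f1]] := h1 g; have [p2 [s2 e2 f2]] := h2 g.
  exists (p1 * p2); split.
  + by rewrite (leq_trans (size_polyMleq _ _)) // (leq_trans (leq_pred _)) // leq_add.
  + by move=> z u zz hu hw; rewrite hornerM -(e1 z u zz hu hw) -(e2 z u zz hu hw) exprD; ring.
  (* At z = 1 the unitary matrix is the identity, so [p1] and [p2] take the values of [F] and [G] at
     [g], as the product rule requires. *)
  + have one1 : (1 : C) * (1 : C)^*%R = 1.
      by rewrite conjC1 mulr1.
    have o1 : mxU (oneU R n) = 1%:M + (1 - 1) *: P by rewrite subrr scale0r addr0.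
    have o2 : w (oneU R n) = 1%:M + ((1 : C)^*%R - 1) *: P.
      by rewrite conjC1 subrr scale0r addr0 invmxU1.
    have := e2 1 _ one1 o1 o2; have := e1 1 _ one1 o1 o2.
    rewrite (mul1U g) !expr1n !mul1r => v1 v2.
    by rewrite f1 f2 v1 v2 derivM hornerD !hornerM natrD; ring.
Qed.

Variable mu : probability (borelU R n) R.
Hypothesis haarP : is_haar mu.

(** As P is idempotent, multiplying 1 + (z - 1) P by its adjoint gives 1 + (|z|^2 - 1) P. *)
Lemma unitary_rot (P : 'M[C]_n) (z : C) : P *m P = P -> P^t* = P -> z * z^*%R = 1 ->
  exists2 u : U, mxU u = 1%:M + (z - 1) *: P & w u = 1%:M + (z^*%R - 1) *: P.
Proof.
move=> PP PJ zz.
have adj : (1%:M + (z - 1) *: P)^t* = 1%:M + (z^*%R - 1) *: P.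
  rewrite linearD linearZ /= trmx1 map_mxD map_mx1 map_mxZ PJ.
  by congr (_ + _ *: _); rewrite rmorphB; congr (_ - _); exact: conjC1.
have uP : 1%:M + (z - 1) *: P \is unitarymx.
  apply/unitarymxP; rewrite adj mulmxDl !mulmxDr !mul1mx mulmx1 -scalemxAl -scalemxAr PP.
  rewrite scalerA -addrA -!scalerDl [X in _ + X *: P](_ : _ = 0) ?scale0r ?addr0 //.
  by transitivity (z * z^*%R - 1); [ring|rewrite zz subrr].
by exists (mkU uP); rewrite // invmxUE.
Qed.

(** The exponent and the degree bound from [lder_laurent] are uniform in [g], so one interpolation
    formula writes [F' P] as a fixed combination of translates of [F]. Invariance turns its integral
    into the integral of [F] times the sum of the weights, and that sum is the derivative of a
    constant. *)
Lemma cint_lder_proj (P : 'M[C]_n) F F' : P *m P = P -> P^t* = P -> lder F F' -> cint mu (F' P) = 0.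
Proof.
move=> PP PJ dF; have [M [N0 H]] := lder_laurent P dF; have [rF rF'] := lder_bmfun dF.
(* The summand [M.+1] makes room for 'X^M, to which the formula is applied at the end. *)
pose N := (N0 + M.+1)%N.
have [z [b [zz hb]]] := unit_interp N (fun k => k%:R - M%:R).
pose u i : U := sval (cid2 (unitary_rot PP PJ (zz i))).
have u1 i : mxU (u i) = 1%:M + (z i - 1) *: P by rewrite /u; case: cid2.
have u2 i : w (u i) = 1%:M + ((z i)^*%R - 1) *: P by rewrite /u; case: cid2.
have dE (p : {poly C}) : (size p <= N)%N ->
   p^`().[1] - M%:R * p.[1] = \sum_i b i * p.[z i].
  move=> sp; rewrite -hb //.
  have pE : p = \sum_(k < N) p`_k *: 'X^k.
    rewrite -poly_def; apply/polyP => k; rewrite coef_poly; case: ltnP => // Nk.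
    by rewrite nth_default // (leq_trans sp).
  rewrite [in p^`()]pE [in p.[1]]pE raddf_sum !horner_sum mulr_sumr -sumrB; apply: eq_bigr => k _ /=.
  rewrite derivZ derivXn !hornerZ hornerMn !hornerXn !expr1n mulr1 -mulr_natr; ring.
have -> : F' P = fun g => \sum_i b i * z i ^+ M * F (mulU (u i) g).
  apply/funext => g; have [p [sp e1 ->]] := H g.
  rewrite dE; last by rewrite (leq_trans sp) // leq_addr.
  by apply: eq_bigr => i _; rewrite -(e1 _ (u i)) // mulrA.
rewrite cint_sum; last first.
  by move=> i; apply: bmfun_mul; [exact: bmfun_cst|exact: bmfun_mulU].
transitivity (\sum_i b i * z i ^+ M * cint mu F).
  by apply: eq_bigr => i _; rewrite cintZ ?cint_mulU //; exact: bmfun_mulU.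
(* The total weight is the formula applied to 'X^M, that is the derivative at 1 of the constant
   'X^-M * 'X^M. *)
rewrite -mulr_suml.
have -> : \sum_i b i * z i ^+ M = \sum_i b i * ('X^M).[z i].
  by apply: eq_bigr => i _; rewrite hornerXn.
rewrite -dE ?size_polyXn ?leq_addl //.
by rewrite derivXn hornerMn !hornerXn !expr1n mulr1 subrr mul0r.
Qed.

Lemma cint_lderD F F' X Y a : lder F F' ->
  cint mu (F' (a *: X + Y)) = a * cint mu (F' X) + cint mu (F' Y).
Proof.
move=> dF; have [_ rF'] := lder_bmfun dF.
have -> : F' (a *: X + Y) = fun g => a * F' X g + F' Y g.
  by apply/funext => g; exact: (lder_linear dF).
have ra : bmfun (fun g => a * F' X g) by apply: bmfun_mul; [exact: bmfun_cst|exact: rF'].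
by rewrite cintD ?cintZ //; exact: rF'.
Qed.

Lemma cint_lder0 F F' : lder F F' -> cint mu (F' 0) = 0.
Proof.
move=> dF; have := cint_lderD 0 0 (-1) dF.
by rewrite scaler0 addr0 mulN1r addNr.
Qed.

(** The integral is linear in the direction and vanishes on Hermitian projections, which span all
    matrices by polarisation. *)
Lemma cint_lder (X : 'M[C]_n) F F' : lder F F' -> cint mu (F' X) = 0.
Proof.
move=> dF.
have proj1 i : cint mu (F' (delta_mx i i)) = 0.
  apply: cint_lder_proj dF; first by rewrite mul_delta_mx.
  by rewrite trmx_delta map_delta_mx.
have LZ a Y : cint mu (F' (a *: Y)) = a * cint mu (F' Y).
  by rewrite -[a *: Y]addr0 (cint_lderD _ _ _ dF) (cint_lder0 dF) addr0.
have LD Y Z : cint mu (F' (Y + Z)) = cint mu (F' Y) + cint mu (F' Z).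
  by rewrite -[Y in LHS]scale1r (cint_lderD _ _ _ dF) mul1r.
(* The row v = e_i + z e_j has squared norm 2, so half of v^* v is a projection; its diagonal
   contributions vanish by [proj1]. *)
have proj2 i j (z : C) : i != j -> z * z^*%R = 1 ->
  z * cint mu (F' (delta_mx i j)) + z^*%R * cint mu (F' (delta_mx j i)) = 0.
  move=> ij zz; have ji : j != i by rewrite eq_sym.
  pose v : 'rV[C]_n := delta_mx 0 i + z *: delta_mx 0 j.
  have vJ : v^t* = delta_mx i 0 + z^*%R *: delta_mx j 0.
    by rewrite linearD linearZ /= !trmx_delta map_mxD map_mxZ !map_delta_mx.
  have vv : v *m v^t* = 2%:M.
    rewrite vJ mulmxDl !mulmxDr -!(scalemxAl, scalemxAr) !mul_delta_mx_cond !eqxx.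
    rewrite (negbTE ij) (negbTE ji) !mulr1n !mulr0n !scaler0 addr0 add0r scalerA zz scale1r.
    by apply/matrixP => a b; rewrite !ord1 !mxE eqxx /= -natrD.
  have vE : v^t* *m v = delta_mx i i + (z *: delta_mx i j + (z^*%R *: delta_mx j i + delta_mx j j)).
    rewrite vJ mulmxDl !mulmxDr -!(scalemxAl, scalemxAr) !mul_delta_mx scalerA mulrC zz scale1r.
    by rewrite -addrA.
  have : cint mu (F' (2^-1 *: (v^t* *m v))) = 0.
    apply: cint_lder_proj dF.
      rewrite -scalemxAl -scalemxAr mulmxA -(mulmxA _ v) vv mul_mx_scalar -scalemxAl.
      by rewrite (scalerA _ 2) mulVf ?pnatr_eq0 // scale1r.
    have half : (2^-1 : C)^*%R = 2^-1 by rewrite fmorphV rmorph_nat.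
    rewrite linearZ /= map_mxZ [X in X *: _]half trmx_mul map_mxM.
    by rewrite trmxCK.
  rewrite LZ vE !LD !LZ !proj1 add0r addr0 => /eqP.
  by rewrite mulf_eq0 invr_eq0 pnatr_eq0 /= => /eqP.
have delta i j : cint mu (F' (delta_mx i j)) = 0.
  have [->|ij] := eqVneq i j; first exact: proj1.
  (* Taking z = 1 and z = i shows that the sum and the difference of the two off-diagonal integrals
     are zero. *)
  have := proj2 i j 1 ij; rewrite conjC1 !mul1r => /(_ erefl) h1.
  have := proj2 i j 'i ij; rewrite conjCi mulrN -expr2 sqrCi opprK => /(_ erefl).
  rewrite mulNr -mulrBr => /eqP; rewrite mulf_eq0 (negbTE (neq0Ci _)) /= subr_eq0 => /eqP h2.
  by move/eqP: h1; rewrite -h2 -mulr2n mulrn_eq0 /= => /eqP.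
rewrite [X]matrix_sum_delta.
elim/big_ind: _ => [|Y Z hY hZ|i _]; first exact: cint_lder0 dF.
  by rewrite LD hY hZ addr0.
elim/big_ind: _ => [|Y Z hY hZ|j _]; first exact: cint_lder0 dF.
  by rewrite LD hY hZ addr0.
by rewrite LZ delta mulr0.
Qed.

End LeftDerivative.

(** * Sums over partitions *)

Section Partitions.

Lemma geq_trans : transitive geq.
Proof. by move=> a b c /= h1 h2; exact: leq_trans h2 h1. Qed.

(** Positive terms come first and each uses at least one unit of the sum. *)
Lemma sorted_geq_drop (s : seq nat) : sorted geq s -> all (pred1 0%N) (drop (sumn s) s).
Proof.
elim: s => [|x s IHs] //= xs.
have ss := path_sorted xs.
case: x xs => [|x] xs.
  rewrite add0n; have : all (pred1 0%N) (0%N :: s).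
    by rewrite /= (sub_all _ (order_path_min geq_trans xs)) // => y /=; rewrite leqn0.
  move=> h; apply/allP => y /mem_drop; exact: (allP h).
rewrite addSn /= -drop_drop; apply/allP => y /mem_drop; exact: (allP (IHs ss)).
Qed.

Lemma leq_sumn_mem (s : seq nat) x : x \in s -> (x <= sumn s)%N.
Proof.
elim: s => //= y s IHs; rewrite inE => /predU1P [->|/IHs]; first exact: leq_addr.
by move/leq_trans; apply; exact: leq_addl.
Qed.

(** Cutting or padding [s] to length [d] only removes or adds zeros, by [sorted_geq_drop]. *)
Lemma intpart_exists d (s : seq nat) : sorted geq s -> sumn s = d ->
  exists mu : intpart d, parts mu = take d s ++ nseq (d - size s) 0%N.
Proof.
move=> ss sd; set t := take d s ++ _.
have dz : all (pred1 0%N) (drop d s) by rewrite -sd; exact: sorted_geq_drop.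
have st : size t = d.
  rewrite size_cat size_nseq size_take_min minnC /minn; case: ltnP => h; first by rewrite subnKC // ltnW.
  by move: h; rewrite -subn_eq0 => /eqP ->; rewrite addn0.
have sumt : sumn t = d.
  rewrite sumn_cat sumn_nseq mul0n addn0 -[RHS]sd -{2}(cat_take_drop d s) sumn_cat.
  move/all_pred1P: dz => ->; by rewrite sumn_nseq mul0n addn0.
have sortt : sorted geq t.
  rewrite (sorted_pairwise geq_trans) pairwise_cat -!(sorted_pairwise geq_trans) take_sorted //=.
  apply/andP; split.
    by apply/allrelP => x y _ /nseqP [-> _].
  by elim: (d - size s)%N => [|[|k] IHk].
have let_ x : x \in t -> (x < d.+1)%N.
  move=> xt; rewrite ltnS -sumt; exact: leq_sumn_mem.
pose u := [tuple inord (nth 0%N t i) | i < d] : d.-tuple 'I_d.+1.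
have uE : [seq val i | i <- u] = t.
  apply: (@eq_from_nth _ 0%N); first by rewrite size_map size_tuple st.
  move=> i; rewrite size_map size_tuple => id_.
  rewrite (nth_map ord0) ?size_tuple // -(tnth_nth _ _ (Ordinal id_)) tnth_mktuple /= inordK //.
  by apply: let_; rewrite mem_nth // st.
have Pu : sorted geq [seq val i | i <- u] && (sumn [seq val i | i <- u] == d).
  by rewrite uE sortt sumt eqxx.
by exists (exist _ u Pu).
Qed.

Lemma parts_inj d : injective (@parts d).
Proof. by move=> m1 m2 e; apply: val_inj; apply: val_inj; apply: (@inj_map _ _ (@nat_of_ord d.+1) (@ord_inj d.+1)); exact: e. Qed.

Lemma parts_sorted d (mu : intpart d) : sorted geq (parts mu).
Proof. by case/andP: (valP mu). Qed.

Lemma sumn_parts d (mu : intpart d) : sumn (parts mu) = d.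
Proof. by case/andP: (valP mu) => _ /eqP. Qed.

Lemma size_parts d (mu : intpart d) : size (parts mu) = d.
Proof. by rewrite size_map size_tuple. Qed.

Lemma parts_le d (mu : intpart d) x : x \in parts mu -> (x <= d)%N.
Proof. by rewrite -{2}(sumn_parts mu); exact: leq_sumn_mem. Qed.

Lemma big_part (F : comPzSemiRingType) d (mu : intpart d) (a : nat -> F) :
  \prod_(j < plength mu) a (part mu j) = \prod_(x <- parts mu | (0 < x)%N) a x.
Proof.
rewrite /part /plength; move: (parts_sorted mu); elim: (parts mu) => [|x s IHs] xs /=.
  by rewrite big_nil big_ord0.
rewrite big_cons; case: x xs => [|x] xs /=.
  have s0 i : i \in s -> i = 0%N.
    by move/(allP (order_path_min geq_trans xs)); rewrite /= leqn0 => /eqP.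
  rewrite add0n (_ : count _ s = 0%N); last first.
    by rewrite (@eq_in_count _ _ pred0) ?count_pred0 // => i si; rewrite (s0 i si).
  by rewrite big_ord0 big1_seq // => i /andP [i0 si]; rewrite (s0 i si) in i0.
by rewrite add1n big_ord_recl /= IHs // (path_sorted xs).
Qed.

Lemma prod_count (F : comPzSemiRingType) (s : seq nat) (a : nat -> F) D :
  all (fun x => x <= D)%N s ->
  \prod_(x <- s | (0 < x)%N) a x = \prod_(i < D) a i.+1 ^+ count_mem i.+1 s.
Proof.
elim: s => [|x s IHs] /= => [_|/andP [xD sD]].
  by rewrite big_nil big1.
rewrite big_cons IHs //; case: x xD => [|x] xD /=.
  by apply: eq_bigr => i _.
rewrite (bigD1 (Ordinal xD)) // [in RHS](bigD1 (Ordinal xD)) //= eqxx exprD expr1 mulrA.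
by congr (_ * _); apply: eq_bigr => i ix; rewrite eqSS eq_sym [_ == x](negbTE ix).
Qed.

Lemma sumn_count (s : seq nat) D :
  all (fun x => x <= D)%N s -> sumn s = (\sum_(i < D) i.+1 * count_mem i.+1 s)%N.
Proof.
elim: s => [|x s IHs] /= => [_|/andP [xD sD]].
  by rewrite big1 // => i _; rewrite muln0.
rewrite IHs //; case: x xD => [|x] xD /=.
  by rewrite add0n; apply: eq_bigr => i _.
rewrite (bigD1 (Ordinal xD)) // [in RHS](bigD1 (Ordinal xD)) //= eqxx mulnDr muln1 addnA.
by congr (_ + _)%N; apply: eq_bigr => i ix; rewrite eqSS eq_sym [_ == x](negbTE ix).
Qed.

Lemma zpart_count d (mu : intpart d) D : (d <= D)%N ->
  zpart mu = (\prod_(i < D) (i.+1 ^ pmult mu i.+1 * (pmult mu i.+1)`!))%N.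
Proof.
move=> dD; rewrite /zpart (big_addn 0 d.+1 1) subn1 big_mkord /=.
rewrite -(big_mkord xpredT (fun i => i.+1 ^ pmult mu i.+1 * (pmult mu i.+1)`!)%N).
rewrite [RHS](@big_cat_nat _ _ _ d) //= [X in (_ * X)%N](_ : _ = 1%N) ?muln1.
  by rewrite big_mkord; apply: eq_bigr => i _; rewrite addn1.
rewrite big_nat_cond big1 // => i /andP [/andP [di _] _]; rewrite (_ : pmult mu i.+1 = 0%N) //.
by apply/count_memPn/negP => /parts_le; rewrite ltnNge di.
Qed.

Lemma pmult_le d (mu : intpart d) r : (pmult mu r <= d)%N.
Proof. by rewrite -[X in (_ <= X)%N](size_parts mu) count_size. Qed.

Lemma count_take_nseq d (s : seq nat) r : sorted geq s -> sumn s = d -> (0 < r)%N ->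
  count_mem r (take d s ++ nseq (d - size s) 0%N) = count_mem r s.
Proof.
move=> ss sd r0; have := sorted_geq_drop ss; rewrite sd => dz.
rewrite -[in RHS](cat_take_drop d s) !count_cat; congr (_ + _)%N.
have r0' : (0%N == r) = false by case: r r0.
rewrite count_nseq /= r0' /= (eq_in_count (a2 := pred0)) ?count_pred0 // => x /(allP dz) /= /eqP ->.
exact: r0'.
Qed.

(** Partitions recorded by multiplicities: this is the index type obtained when a product of [D]
    sums of [D.+1] terms is expanded. The cast is faithful when [d <= D], see [multsE]. *)
Definition mults D d (mu : intpart d) : {ffun 'I_D -> 'I_D.+1} :=
  [ffun i : 'I_D => inord (pmult mu i.+1)].

Lemma multsE D d (mu : intpart d) i : (d <= D)%N -> mults D mu i = pmult mu i.+1 :> nat.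
Proof.
by move=> dD; rewrite ffunE inordK // ltnS (leq_trans (pmult_le _ _) dD).
Qed.

Lemma mults_inj D d : (d <= D)%N -> injective (@mults D d).
Proof.
move=> dD m1 m2 e; apply: parts_inj.
have ge_anti : antisymmetric geq by move=> x y; rewrite andbC => /anti_leq.
apply: (sorted_eq geq_trans ge_anti); try exact: parts_sorted.
have pos r : (0 < r)%N -> count_mem r (parts m1) = count_mem r (parts m2).
  case: r => // r _; have [rD|Dr] := ltnP r D.
    have := congr1 (fun f : {ffun 'I_D -> 'I_D.+1} => nat_of_ord (f (Ordinal rD))) e.
    by rewrite !multsE.
  have z (m : intpart d) : count_mem r.+1 (parts m) = 0%N.
    by apply/count_memPn/negP => /parts_le; rewrite leqNgt ltnS (leq_trans dD Dr).
  by rewrite !z.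
apply/allP => r _ /=; case: r => [|r]; last by rewrite pos.
(* The number of zeros is determined by the positive multiplicities, because all the lists have
   length [d]. *)
have cnt (m : intpart d) : (count_mem 0%N (parts m) + \sum_(i < d) count_mem i.+1 (parts m))%N = d.
  rewrite -[RHS](size_parts m); have : all (fun x => x <= d)%N (parts m) by apply/allP => x /parts_le.
  elim: (parts m) => [|x s IHs] /=; first by rewrite big1.
  case/andP => xd /IHs <-; rewrite big_split /=; case: x xd => [|x] xd /=.
    by rewrite big1 ?add0n // add1n addSn.
  rewrite add0n addnCA -[RHS]add1n; congr (_ + _)%N.
  rewrite (bigD1 (Ordinal xd)) //= eqxx big1 // => i ix; by rewrite eqSS eq_sym [_ == x](negbTE ix).
apply/eqP/(@addIn (\sum_(i < d) count_mem i.+1 (parts m1))%N).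
by rewrite cnt; under eq_bigr do rewrite pos //; rewrite cnt.
Qed.

Lemma mults_sum D d (mu : intpart d) : (d <= D)%N -> (\sum_(i < D) i.+1 * mults D mu i)%N = d.
Proof.
move=> dD; under eq_bigr do rewrite multsE //.
rewrite -sumn_count ?sumn_parts //; apply/allP => x /parts_le /leq_trans; exact.
Qed.

(** The partition is obtained by sorting the list with [f i] copies of each [i.+1]. *)
Lemma mults_surj D d (f : {ffun 'I_D -> 'I_D.+1}) : (d <= D)%N ->
  (\sum_(i < D) i.+1 * f i)%N = d -> exists mu : intpart d, f = mults D mu.
Proof.
move=> dD fd; pose s0 := flatten [seq nseq (f i) i.+1 | i <- enum 'I_D].
pose s := sort geq s0.
have ss : sorted geq s by apply: sort_sorted => x y; rewrite orbC leq_total.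
have ps : perm_eq s s0 by rewrite perm_sort.
have sd : sumn s = d.
  rewrite (perm_sumn ps) /s0 sumn_flatten -map_comp -fd sumnE big_map big_enum /=.
  by apply: eq_bigr => i _; rewrite sumn_nseq.
have [mu muE] := intpart_exists ss sd.
exists mu; apply/ffunP => i; apply: val_inj; rewrite /= multsE // /pmult muE count_take_nseq //.
move/seq.permP: ps => ->; rewrite /s0 count_flatten -map_comp sumnE big_map big_enum /= (bigD1 i) //=.
rewrite count_nseq /= eqxx mul1n big1 ?addn0 // => j ji.
by rewrite count_nseq /= eqSS [_ == _](negbTE ji) mul0n.
Qed.

(** * Power-sum expansions and their Newton recurrence *)

Section PowerSums.
Variable F : numFieldType.
Implicit Types (a : nat -> F).

(** The coefficient of degree [d] in exp (sum_r a_r X^r / r); when the [a r] are power sums this is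
    the complete homogeneous symmetric function. *)
Definition psum a d : F :=
  \sum_(mu : intpart d) (\prod_(j < plength mu) a (part mu j)) / (zpart mu)%:R.

(* [exp (a_r 'X^r / r)] truncated. *)
Definition expo D r a : {poly F} := \sum_(m < D.+1) (a r ^+ m / (r ^ m * m`!)%:R) *: 'X^(r * m).

(* [L] is the logarithmic derivative of [G] up to degree [D]; it is additive on products. *)
Definition logder D (G L : {poly F}) := exists R, 'X * G^`() = L * G + 'X^(D.+1) * R.

Lemma logder1 D : logder D 1 0.
Proof. by exists 0; rewrite derivC !mulr0 mul0r addr0. Qed.

Lemma logderM D G G' L L' : logder D G L -> logder D G' L' -> logder D (G * G') (L + L').
Proof.
move=> [R h] [R' h']; exists (R * G' + G * R').
by rewrite derivM mulrDr mulrA h (mulrCA 'X) h'; ring.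
Qed.

Lemma logder_prod (I : Type) (s : seq I) (P : pred I) D (G L : I -> {poly F}) :
  (forall i, P i -> logder D (G i) (L i)) ->
  logder D (\prod_(i <- s | P i) G i) (\sum_(i <- s | P i) L i).
Proof.
move=> h; elim/big_rec2: _ => [|i L' G' Pi h']; first exact: logder1.
by apply: logderM => //; exact: h.
Qed.

Lemma logder_coef D G L d : logder D G L -> (d <= D)%N ->
  d%:R * G`_d = \sum_(k < d.+1) L`_k * G`_(d - k).
Proof.
move=> [R h] dD; rewrite -coefM; have := congr1 (fun p : {poly F} => p`_d) h.
rewrite coefD coefXM coef_deriv coefXnM ltnS dD addr0 => <-.
by case: d dD => [|d] _; rewrite ?mul0r // mulr_natl.
Qed.

Lemma logder_expo D r a : (0 < r)%N -> logder D (expo D r a) (a r *: 'X^r).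
Proof.
(* Truncation spoils the exponential equation only in the last term of [a r *: 'X^r * expo D r a],
   of degree [r * D.+1]; this is that term with 'X^(D.+1) taken out. *)
move=> r0; exists (- (a r ^+ D.+1 / (r ^ D * D`!)%:R) *: 'X^(r * D.+1 - D.+1)).
have rD : (D.+1 <= r * D.+1)%N by rewrite leq_pmull.
rewrite -scalerAr -exprD subnKC // /expo raddf_sum mulr_sumr big_ord_recl /= muln0 expr0.
rewrite derivZ derivC scaler0 mulr0 add0r mulr_sumr big_ord_recr /= -scalerAl -scalerAr -exprD -mulnS scalerA.
rewrite scaleNr exprS mulrA addrK; apply: eq_bigr => m _; rewrite /bump /= add1n.
rewrite derivZ derivXn -[LHS]scalerAr mulrnAr -exprS prednK ?muln_gt0 ?r0 //.
rewrite -[_ *+ (r * _)]scaler_nat scalerA -[RHS]scalerAl -scalerAr scalerA -exprD -mulnS natrM; congr (_ *: _).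
rewrite exprS expnS factS !natrM.
have : (r ^ m)%:R != 0 :> F by rewrite pnatr_eq0 -lt0n expn_gt0 r0.
have : m`!%:R != 0 :> F by rewrite pnatr_eq0 -lt0n fact_gt0.
have : r%:R != 0 :> F by rewrite pnatr_eq0 -lt0n.
have : m.+1%:R != 0 :> F by rewrite pnatr_eq0.
move: (a r ^+ m) (m.+1%:R) (r%:R) (m`!%:R) ((r ^ m)%:R) => A x y z t x0 y0 z0 t0.
by field; rewrite ?x0 ?y0 ?z0 ?t0.
Qed.

Definition exps D a : {poly F} := \prod_(r < D) expo D r.+1 a.

Lemma exps_coef D a d : (d <= D)%N -> (exps D a)`_d = psum a d.
Proof.
move=> dD; rewrite /exps /expo bigA_distr_bigA /= coef_sum /psum.
transitivity (\sum_(f : {ffun 'I_D -> 'I_D.+1} | (\sum_(i < D) i.+1 * f i == d)%N)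
   \prod_(i < D) (a i.+1 ^+ f i / (i.+1 ^ f i * (f i)`!)%:R)).
  rewrite [RHS]big_mkcond /=; apply: eq_bigr => f _.
  rewrite scaler_prod -(big_morph _ (exprD _) (expr0 _)) coefZ coefXn eq_sym.
  by case: ifP; rewrite ?mulr1 ?mulr0.
transitivity (\sum_(f in [set mults D mu | mu : intpart d])
   \prod_(i < D) (a i.+1 ^+ f i / (i.+1 ^ f i * (f i)`!)%:R)).
  apply: eq_bigl => f; apply/eqP/imsetP => [fd|[mu _ ->]]; last exact: mults_sum.
  by have [mu ->] := mults_surj dD fd; exists mu.
rewrite big_imset /=; last by move=> ? ? _ _; exact: mults_inj.
apply: eq_bigr => mu _.
rewrite big_part (@prod_count _ _ _ D); last by apply/allP => x /parts_le /leq_trans; exact.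
rewrite big_split /= (zpart_count mu dD) natr_prod -prodfV; congr (_ * _);
  apply: eq_bigr => i _; rewrite multsE //.
Qed.

(** Newton's recurrence, read off from the logarithmic derivative sum_r a_r X^r of the generating
    function. *)
Lemma psum_rec a d : d%:R * psum a d = \sum_(k < d) a k.+1 * psum a (d - k.+1).
Proof.
have h : logder d (exps d a) (\sum_(r < d) a r.+1 *: 'X^(r.+1)).
  by apply: logder_prod => r _; exact: logder_expo.
rewrite -(@exps_coef d) // (logder_coef h) // big_ord_recl coef_sum big1 ?mul0r ?add0r; last first.
  by move=> i _; rewrite coefZ coefXn mulr0.
apply: eq_bigr => k _; rewrite -(@exps_coef d) ?leq_subr //; congr (_ * _).
rewrite coef_sum (bigD1 k) //= coefZ coefXn eqxx mulr1 big1 ?addr0 // => i ik.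
by rewrite coefZ coefXn eqSS [_ == _]eq_sym [_ == _](negbTE ik) mulr0.
Qed.

Lemma psum0 a : psum a 0 = 1.
Proof. by rewrite -(@exps_coef 0) // /exps big_ord0 coef1. Qed.

End PowerSums.

End Partitions.

(** * The reproducing property *)

Section HomogeneousPolynomials.
Variables (K : comNzRingType) (k : nat).
Local Notation mpol := (mpoly.mpoly k K).
Local Notation homog d := (mpoly.ishomog1 d mpoly.mdeg).

Lemma meval_euler d (p : mpol) (v : 'I_k -> K) : p \is homog d ->
  \sum_i v i * mpoly.meval v (mpoly.mderiv i p) = d%:R * mpoly.meval v p.
Proof.
move=> hp.
have dE i : mpoly.meval v (mpoly.mderiv i p) = \sum_(m <- mpoly.msupp p)
    mpoly.mcoeff m p * ((m i)%:R * \prod_j v j ^+ (mpoly.mnm_sub m (mpoly.mnm1 i)) j).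
  rewrite {1}(mpoly.mpolyE p) (raddf_sum (mpoly.mderiv i)) (raddf_sum (mpoly.meval v)).
  by apply: eq_bigr => m _; rewrite /= mpoly.mderivZ mpoly.mderivX !mpoly.mevalZ mpoly.mevalX.
under eq_bigr do rewrite dE mulr_sumr.
rewrite exchange_big /= mpoly.mevalE mulr_sumr; apply: eq_big_seq => m mp.
have <- : mpoly.mdeg m = d by have /mpoly.dhomogP := hp; apply.
rewrite mpoly.mdegE natr_sum mulr_suml; apply: eq_bigr => i _.
(* The truncated subtraction [m - 1] is harmless when [m i = 0], since the factor [m i] kills the
   term. *)
have [mi0|mi0] := posnP (m i); first by rewrite mi0 !mul0r !mulr0.
rewrite mulrCA (mulrCA (v i)) [RHS]mulrCA; congr (_ * (_ * _)).
rewrite (bigD1 i) //= [RHS](bigD1 i) //= mulrA.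
rewrite mpoly.mnmBE mpoly.mnm1E eqxx -exprS subn1 prednK //; congr (_ * _).
by apply: eq_bigr => j ji; rewrite mpoly.mnmBE mpoly.mnm1E eq_sym (negbTE ji) subn0.
Qed.

Lemma mderiv_homog d (p : mpol) i : p \is homog d.+1 -> mpoly.mderiv i p \is homog d.
Proof.
move=> hp; apply/mpoly.dhomogP => m; rewrite mpoly.mcoeff_msupp mpoly.mcoeff_mderiv.
have [z|nz] := eqVneq (mpoly.mcoeff (mpoly.mnm_add m (mpoly.mnm1 i)) p) 0.
  by rewrite z mul0rn eqxx.
move=> _; move/mpoly.dhomogP: hp => /(_ (mpoly.mnm_add m (mpoly.mnm1 i))).
by rewrite mpoly.mcoeff_msupp => /(_ nz) /=; rewrite mpoly.mdegD mpoly.mdeg1 addn1 => -[].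
Qed.

Lemma meval_homog0 (p : mpol) v v' : p \is homog 0 -> mpoly.meval v p = mpoly.meval v' p.
Proof.
move=> hp; rewrite !mpoly.mevalE; apply: eq_big_seq => m mp.
have : mpoly.mdeg m = 0%N by have /mpoly.dhomogP := hp; apply.
move/eqP; rewrite mpoly.mdeg_eq0 => /eqP ->.
by congr (_ * _); apply: eq_bigr => i _; rewrite mpoly.mnm0E !expr0.
Qed.

End HomogeneousPolynomials.

(** * The asserted kernel reproduces evaluation at the identity *)

Section Kernel.
Variables (R : realType) (n : nat).
Local Notation U := (unitary_group R n).
Local Notation C := R[i].
Local Notation w := (@invmxU R n).
Local Notation homog d := (mpoly.ishomog1 d mpoly.mdeg).
Local Notation ev g := (mpoly.meval (fun k => mxvec (@mxU R n g) 0 k)).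
Local Open Scope sesquilinear_scope.

Lemma lder_sum (I : Type) (s : seq I) (P : pred I) (F : I -> U -> C) F' :
  (forall i, P i -> lder (F i) (F' i)) ->
  lder (fun g => \sum_(i <- s | P i) F i g) (fun X g => \sum_(i <- s | P i) F' i X g).
Proof.
move=> h; elim: s => [|i s IHs].
  by apply: (lder_ext (lder_cst n 0) _ _) => [g|X g]; rewrite big_nil.
have [Pi|Pi] := boolP (P i).
  by apply: (lder_ext (lder_add (h i Pi) IHs) _ _) => [g|X g]; rewrite big_cons Pi.
by apply: (lder_ext IHs _ _) => [g|X g]; rewrite big_cons (negbTE Pi).
Qed.

Lemma lder_scale c (F : U -> C) F' : lder F F' -> lder (fun g => c * F g) (fun X g => c * F' X g).
Proof. by move=> dF; apply: (lder_ext (lder_mul (lder_cst n c) dF) _ _) => [g|X g]; rewrite // mul0r add0r. Qed.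

Lemma lder_pow m i j : lder (fun g => (w g ^+ m) i j)
  (fun X g => - \sum_(s < m) (w g ^+ s.+1 * X * w g ^+ (m - s.+1)) i j).
Proof.
elim: m i j => [|m IHm] i j.
  by apply: (lder_ext (lder_cst n ((1 : 'M[C]_n) i j)) _ _) => [g|X g]; rewrite ?expr0 // big_ord0 oppr0.
have dE := lder_sum (index_enum 'I_n) (P := xpredT) (fun k _ => lder_mul (lder_inv R i k) (IHm k j)).
apply: (lder_ext dE _ _) => [g|X g].
  by rewrite exprS [RHS]mxE.
rewrite big_split big_ord_recl /= subSS subn0 expr1 opprD; congr (_ + _).
  by rewrite [in RHS]mxE -sumrN; apply: eq_bigr => k _; rewrite mulNr.
under eq_bigr do rewrite mulrN mulr_sumr.
rewrite sumrN exchange_big /=; congr (- _); apply: eq_bigr => s _.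
by rewrite /bump /= add1n subSS [in RHS]exprS -!mulrA [RHS]mxE.
Qed.

(** Cyclicity of the trace makes the [m] terms of the product rule equal. *)
Lemma lder_trpow m : lder (fun g => \tr (w g ^+ m)) (fun X g => - m%:R * \tr (w g ^+ m *m X)).
Proof.
apply: (lder_ext (lder_sum (index_enum 'I_n) (P := xpredT) (fun i _ => lder_pow m i i)) _ _) => [g|X g] //.
rewrite sumrN exchange_big mulNr /=; congr (- _).
rewrite mulr_natl -[X in _ *+ X](card_ord m) -sumr_const; apply: eq_bigr => s _.
rewrite -[LHS]/(\tr (w g ^+ s.+1 * X * w g ^+ (m - s.+1))) [LHS]mxtrace_mulC.
by rewrite mulmxA -[X in \tr (X *m _)]exprD subnK.
Qed.

(** K_d at the inverse of [g], equal to the conjugate of K_d at [g] ([trsum_conj]). *)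
Definition wsum d (g : U) : C := psum (fun k => n%:R * \tr (w g ^+ k)) d.

Lemma wsum_rec d g : d%:R * wsum d g = \sum_(k < d) n%:R * \tr (w g ^+ k.+1) * wsum (d - k.+1) g.
Proof. exact: psum_rec. Qed.

Lemma triangle_exchange d (G : nat -> nat -> C) :
  \sum_(k < d) \sum_(m < d - k.+1) G k m = \sum_(m < d) \sum_(k < d - m.+1) G k m.
Proof.
have widen (H : nat -> C) k : \sum_(m < d - k.+1) H m = \sum_(m < d | (k + m.+1 < d)%N) H m.
  rewrite (big_ord_widen d) ?leq_subr //; apply: eq_bigl => m.
  by rewrite ltn_subRL addSnnS.
under eq_bigr do rewrite widen.
under [RHS]eq_bigr do rewrite (widen (fun k => G k _)).
rewrite (exchange_big_dep xpredT) //=; apply: eq_bigr => m _; apply: eq_bigl => k.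
by rewrite addnS -addSn addnC.
Qed.

(** Differentiating Newton's recurrence, the coefficient of tr(w^(m+1) X) K_(d-m-1) receives m + 1
    from the trace and, after exchanging sums and folding the recurrence back, d - m - 1 from the
    induction hypothesis. The total [d] cancels. *)
Lemma lder_wsum d : lder (wsum d)
   (fun X g => - n%:R * \sum_(m < d) \tr (w g ^+ m.+1 *m X) * wsum (d - m.+1) g).
Proof.
elim/ltn_ind: d => -[|d] IHd.
  by apply: (lder_ext (lder_cst n 1) _ _) => [g|X g]; rewrite ?big_ord0 ?mulr0 // /wsum psum0.
have dE := lder_scale d.+1%:R^-1 (lder_sum (index_enum 'I_d.+1) (P := xpredT) (fun k _ =>
   lder_mul (lder_scale n%:R (lder_trpow k.+1)) (IHd (d.+1 - k.+1)%N (leq_subr _ _)))).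
have d0 : d.+1%:R != 0 :> C by rewrite pnatr_eq0.
apply: (lder_ext dE _ _) => [g|X g]; first by rewrite -wsum_rec mulKf.
apply: (mulfI d0); rewrite mulVKf // big_split /=.
rewrite [X in _ + X](_ : _ = - n%:R * \sum_(m < d.+1)
   \tr (w g ^+ m.+1 *m X) * ((d.+1 - m.+1)%:R * wsum (d.+1 - m.+1) g)); last first.
  under eq_bigr => k _ do rewrite mulrCA mulr_sumr.
  rewrite -mulr_sumr; congr (_ * _).
  rewrite (triangle_exchange d.+1 (fun k m => n%:R * \tr (w g ^+ k.+1) * (\tr (w g ^+ m.+1 *m X) *
      wsum (d.+1 - k.+1 - m.+1) g))).
  apply: eq_bigr => m _; rewrite wsum_rec mulr_sumr; apply: eq_bigr => k _.
  by rewrite mulrCA -!subnDA (addnC k.+1).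
rewrite !mulr_sumr -big_split /=; apply: eq_bigr => k _.
by rewrite (natrB _ (ltn_ord k)); ring.
Qed.

(** The chain rule, built up from variables through monomials to sums because [lder] is generated by
    the entries. *)
Lemma lder_ev (p : mpoly.mpoly (n * n) C) :
  lder (fun g => ev g p) (fun X g => \sum_k mxvec (X *m mxU g) 0 k * ev g (mpoly.mderiv k p)).
Proof.
have derM p1 p2 :
    lder (fun g => ev g p1) (fun X g => \sum_k mxvec (X *m mxU g) 0 k * ev g (mpoly.mderiv k p1)) ->
    lder (fun g => ev g p2) (fun X g => \sum_k mxvec (X *m mxU g) 0 k * ev g (mpoly.mderiv k p2)) ->
    lder (fun g => ev g (p1 * p2)) (fun X g => \sum_k mxvec (X *m mxU g) 0 k * ev g (mpoly.mderiv k (p1 * p2))).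
  move=> h1 h2; apply: (lder_ext (lder_mul h1 h2) _ _) => [g|X g]; first by rewrite mpoly.mevalM.
  rewrite mulr_suml mulr_sumr -big_split; apply: eq_bigr => k _ /=.
  by rewrite mpoly.mderivM mpoly.mevalD !mpoly.mevalM; ring.
have der1 : lder (fun g => ev g 1) (fun X g => \sum_k mxvec (X *m mxU g) 0 k * ev g (mpoly.mderiv k 1)).
  apply: (lder_ext (lder_cst n 1) _ _) => [g|X g]; first by rewrite mpoly.meval1.
  by rewrite big1 // => k _; rewrite -mpoly.mpolyC1 mpoly.mderivC mpoly.meval0 mulr0.
elim/mpoly.mpolyind: p => [|c m p _ _ IHp].
  apply: (lder_ext (lder_cst n 0) _ _) => [g|X g]; first by rewrite mpoly.meval0.
  by rewrite big1 // => k _; rewrite mpoly.mderiv0 mpoly.meval0 mulr0.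
have subUU i : mpoly.mnm_sub (mpoly.mnm1 i) (mpoly.mnm1 i) = mpoly.mnm0 :> mpoly.multinom (n * n).
  by apply/mpoly.mnmP => j; rewrite mpoly.mnmBE mpoly.mnm0E subnn.
have dX : lder (fun g => ev g (mpoly.mpolyX C m))
   (fun X g => \sum_k mxvec (X *m mxU g) 0 k * ev g (mpoly.mderiv k (mpoly.mpolyX C m))).
  rewrite mpoly.mpolyXE_id; elim/big_ind: _ => // i _.
  elim: (m i) => [|e IHe]; first by rewrite expr0.
  rewrite exprS; apply: derM => //.
  case/mxvec_indexP: i IHe => a b _.
  apply: (lder_ext (lder_entry R a b) _ _) => [g|X g]; first by rewrite mpoly.mevalXU mxvecE.
  rewrite (bigD1 (mxvec_index a b)) //= big1 ?addr0.
    by rewrite mxvecE mpoly.mderivX mpoly.mnm1E eqxx scale1r subUU mpoly.mpolyX0 mpoly.meval1 mulr1.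
  by move=> k kab; rewrite mpoly.mderivX mpoly.mnm1E eq_sym (negbTE kab) scale0r mpoly.meval0 mulr0.
apply: (lder_ext (lder_add (lder_scale c dX) IHp) _ _) => [g|X g].
  by rewrite mpoly.mevalD mpoly.mevalZ.
rewrite mulr_sumr -big_split; apply: eq_bigr => k _ /=.
by rewrite mpoly.mderivD mpoly.mderivZ mpoly.mevalD mpoly.mevalZ; ring.
Qed.

Lemma lder_contract (F : U -> C) F' (A : 'M[C]_n) g : lder F F' ->
  \sum_i \sum_j A i j * F' (delta_mx i j) g = F' A g.
Proof.
move=> dF; have F'0 : F' 0 g = 0.
  by have := lder_linear dF (-1) 0 0 g; rewrite scaler0 addr0 mulN1r addNr.
have F'Z a X : F' (a *: X) g = a * F' X g.
  by rewrite -[a *: X]addr0 (lder_linear dF) F'0 addr0.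
have F'D X Y : F' (X + Y) g = F' X g + F' Y g.
  by rewrite -[X in LHS]scale1r (lder_linear dF) mul1r.
rewrite [in RHS](matrix_sum_delta A).
rewrite (big_morph (fun X => F' X g) F'D F'0); apply: eq_bigr => i _.
by rewrite (big_morph (fun X => F' X g) F'D F'0); apply: eq_bigr => j _; rewrite F'Z.
Qed.

Variable mu : probability (borelU R n) R.
Hypothesis haarP : is_haar mu.

Lemma cint_contract (F : 'I_n -> 'I_n -> U -> C) (F' : 'I_n -> 'I_n -> 'M[C]_n -> U -> C) :
  (forall i j, lder (F i j) (F' i j)) ->
  cint mu (fun g => \sum_i \sum_j F' i j (delta_mx i j) g) = 0.
Proof.
move=> dF; have rF i j : bmfun (F' i j (delta_mx i j)) by have [_] := lder_bmfun (dF i j); exact.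
rewrite cint_sum => [|i]; last exact: bmfun_sum.
rewrite big1 // => i _; rewrite cint_sum // big1 // => j _.
exact: (cint_lder haarP _ (dF i j)).
Qed.

Lemma bmfun_ev (p : mpoly.mpoly (n * n) C) : bmfun (fun g : U => ev g p).
Proof. by have [] := lder_bmfun (lder_ev p). Qed.

Lemma bmfun_wsum d : bmfun (wsum d).
Proof. by have [] := lder_bmfun (lder_wsum d). Qed.

Lemma cint_ev_wsumS d (p : mpoly.mpoly (n * n) C) : p \is homog d.+1 ->
  d.+1%:R * cint mu (fun g => ev g p * wsum d.+1 g) =
  cint mu (fun g => ev g (\sum_k mxvec (1%:M : 'M[C]_n) 0 k *: mpoly.mderiv k p) * wsum d g).
Proof.
move=> hp; have dp := lder_ev p.
(* The coefficients of the flattened identity matrix select the diagonal variables: [q] is sum_a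
   dp/dg_aa. *)
set q := \sum_k _.
have rp := bmfun_mul (bmfun_ev p) (bmfun_wsum d.+1).
have rq := bmfun_mul (bmfun_ev q) (bmfun_wsum d).
have dF i j := lder_mul dp (lder_add (lder_scale (i == j)%:R (lder_wsum d.+1))
  (lder_scale (-1) (lder_mul (lder_inv R i j) (lder_wsum d)))).
have : cint mu (fun g => d.+1%:R * (ev g p * wsum d.+1 g) + (-1) * (ev g q * wsum d g)) = 0.
  rewrite -(cint_contract dF); apply: cint_ext => g; apply/esym.
  set P := ev g p; set H1 := wsum d.+1 g; set H0 := wsum d g.
  pose A X := \sum_k mxvec (X *m mxU g) 0 k * ev g (mpoly.mderiv k p).
  pose B e X := - n%:R * \sum_(m < e) \tr (w g ^+ m.+1 *m X) * wsum (e - m.+1) g.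
  transitivity (A 1%:M * H1 - A (w g) * H0 + P * (B d.+1 1%:M + n%:R * \tr (w g) * H0 - B d (w g))).
    have eA X : A X = \sum_i \sum_j X i j * A (delta_mx i j) := esym (lder_contract X g dp).
    have eB e X : B e X = \sum_i \sum_j X i j * B e (delta_mx i j) := esym (lder_contract X g (lder_wsum e)).
    (* Differentiating the factor w_ij along E_ij gives - w_ii for each of the [n] values of j. *)
    have -> : n%:R * \tr (w g) = \sum_i \sum_j (w g *m (delta_mx i j : 'M[C]_n)) i j.
      rewrite mulr_sumr; apply: eq_bigr => i _.
      rewrite mulr_natl -[X in _ *+ X](card_ord n) -sumr_const; apply: eq_bigr => j _.
      rewrite mxE (bigD1 i) //= mxE !eqxx mulr1 big1 ?addr0 // => k ki.
      by rewrite mxE (negbTE ki) mulr0.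
    have SZ c (f : 'I_n -> 'I_n -> C) : \sum_i \sum_j c * f i j = c * \sum_i \sum_j f i j.
      by rewrite mulr_sumr; apply: eq_bigr => i _; rewrite mulr_sumr.
    have SD (f h : 'I_n -> 'I_n -> C) : \sum_i \sum_j (f i j + h i j) =
        \sum_i \sum_j f i j + \sum_i \sum_j h i j.
      by rewrite -big_split; apply: eq_bigr => i _; rewrite big_split.
    transitivity (\sum_i \sum_j (H1 * ((1%:M : 'M[C]_n) i j * A (delta_mx i j)) +
       ((- H0) * (w g i j * A (delta_mx i j)) + (P * ((1%:M : 'M[C]_n) i j * B d.+1 (delta_mx i j)) +
       ((P * H0) * (w g *m delta_mx i j) i j + (- P) * (w g i j * B d (delta_mx i j))))))); last first.
      by rewrite !SD !SZ -!eA -!eB; ring.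
    apply: eq_bigr => i _; apply: eq_bigr => j _.
    rewrite -/(A (delta_mx i j)) -/(B d.+1 (delta_mx i j)) -/(B d (delta_mx i j)) -/P -/H1 -/H0.
    by rewrite [(1%:M : 'M[C]_n) i j]mxE; ring.
  (* Along the identity the derivative of [p] is Euler's; along [w g] it gives [q], because w g =
     1. *)
  have -> : A 1%:M = d.+1%:R * P.
    rewrite /A mul1mx; exact: (meval_euler _ hp).
  have -> : A (w g) = ev g q.
    rewrite /A mul_invmxU /q raddf_sum; apply: eq_bigr => k _ /=; by rewrite mpoly.mevalZ.
  (* The first term of [B d.+1 1%:M] cancels n tr(w) K_d, and its remaining terms, shifted by one
     power of [w], are those of [B d (w g)]. *)
  rewrite (_ : B _ _ + _ - _ = 0); first by rewrite mulr0 addr0 mulN1r mulrA.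
  rewrite /B big_ord_recl /= expr1 mulmx1 subSS subn0.
  have -> : \sum_(i < d) \tr (w g ^+ (bump 0 i).+1 *m 1%:M) * wsum (d.+1 - (bump 0 i).+1) g =
     \sum_(m < d) \tr (w g ^+ m.+1 *m w g) * wsum (d - m.+1) g.
    apply: eq_bigr => m _; rewrite /bump /= add1n subSS mulmx1; congr (\tr _ * _).
    by rewrite exprSr.
  by rewrite /H0; ring.
rewrite cintD; first last.
- by apply: bmfun_mul; [exact: bmfun_cst|].
- by apply: bmfun_mul; [exact: bmfun_cst|].
by rewrite !cintZ // mulN1r => /eqP; rewrite subr_eq0 => /eqP.
Qed.

Lemma cint_ev_wsum d (p : mpoly.mpoly (n * n) C) : p \is homog d ->
  cint mu (fun g => ev g p * wsum d g) = ev (oneU R n) p.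
Proof.
elim: d p => [|d IHd] p hp.
  rewrite -[RHS](cint_cst mu); apply: cint_ext => g.
  by rewrite /wsum psum0 mulr1; exact: meval_homog0.
apply: (@mulfI _ d.+1%:R); first by rewrite pnatr_eq0.
rewrite cint_ev_wsumS // IHd.
  (* Euler's identity at the identity matrix: the value of [q] there is [d.+1] times that of [p]. *)
  rewrite -(meval_euler _ hp) raddf_sum; apply: eq_bigr => k _ /=.
  by rewrite mpoly.mevalZ.
by apply: rpred_sum => k _; apply: mpoly.dhomogZ; exact: mderiv_homog.
Qed.

Definition trsum d (g : U) : C := psum (fun k => n%:R * \tr (mxU g ^+ k)) d.

Lemma invmxU_pow g e : w g ^+ e = (mxU g ^+ e)^t*.
Proof.
elim: e => [|e IHe]; first by rewrite !expr0 trmx1 map_mx1.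
by rewrite exprSr IHe invmxUE exprS trmx_mul map_mxM.
Qed.

Lemma trsum_conj d g : (trsum d g)^*%R = wsum d g.
Proof.
rewrite /trsum /wsum /psum rmorph_sum; apply: eq_bigr => m _.
rewrite rmorphM fmorphV rmorph_nat; congr (_ / _).
rewrite rmorph_prod; apply: eq_bigr => j _; rewrite rmorphM rmorph_nat; congr (_ * _).
rewrite invmxU_pow rmorph_sum; apply: eq_bigr => i _; by rewrite !mxE.
Qed.

Lemma trpow_homog e i j : exists2 p : mpoly.mpoly (n * n) C, p \is homog e &
  forall g : U, (mxU g ^+ e) i j = ev g p.
Proof.
elim: e i j => [|e IHe] i j.
  exists (mpoly.mpolyC _ ((1 : 'M[C]_n) i j)); last by move=> g; rewrite mpoly.mevalC.
  by rewrite -[mpoly.mpolyC _ _]mulr1 mpoly.mul_mpolyC; apply: mpoly.dhomogZ; exact: mpoly.dhomog1.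
pose P k := sval (cid2 (IHe k j)).
exists (\sum_k mpoly.mpolyX C (mpoly.mnm1 (mxvec_index i k)) * P k).
  apply: rpred_sum => k _; rewrite -add1n; apply: mpoly.dhomogM; last by rewrite /P; case: cid2.
  by rewrite mpoly.dhomogX /= mpoly.mdeg1.
move=> g; rewrite exprS raddf_sum [LHS]mxE; apply: eq_bigr => k _ /=.
by rewrite mpoly.mevalM mpoly.mevalXU mxvecE /P; case: cid2 => q _ /= ->.
Qed.

(** Puts K_d in the space spanned by the orthonormal basis; Newton's recurrence builds the
    polynomial degree by degree. *)
Lemma trsum_homog d : exists2 p : mpoly.mpoly (n * n) C, p \is homog d &
  forall g : U, trsum d g = ev g p.
Proof.
elim/ltn_ind: d => -[|d] IHd.
  exists 1; first exact: mpoly.dhomog1.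
  by move=> g; rewrite mpoly.meval1 /trsum psum0.
pose P (k : 'I_d.+1) := sval (cid2 (IHd (d.+1 - k.+1)%N (leq_subr _ _))).
pose Q (k : 'I_d.+1) := \sum_i sval (cid2 (trpow_homog k.+1 i i)).
exists (d.+1%:R^-1 *: \sum_k n%:R *: (Q k * P k)).
  apply: mpoly.dhomogZ; apply: rpred_sum => k _; apply: mpoly.dhomogZ.
  rewrite -[X in mpoly.ishomog1 X _](subnKC (ltn_ord k)); apply: mpoly.dhomogM.
    by apply: rpred_sum => i _; case: cid2.
  by rewrite /P; case: cid2.
move=> g; rewrite mpoly.mevalZ raddf_sum /=.
have d0 : d.+1%:R != 0 :> C by rewrite pnatr_eq0.
apply: (mulfI d0); rewrite mulVKf // /trsum psum_rec; apply: eq_bigr => k _ /=.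
rewrite mpoly.mevalZ mpoly.mevalM mulrA; congr (_ * _ * _).
  by rewrite /Q raddf_sum; apply: eq_bigr => i _ /=; case: cid2 => q _ /= <-.
by rewrite /P; case: cid2 => q _ /= <-.
Qed.

Lemma inner_prodE (f h : U -> C) : inner_prod mu f h = cint mu (fun x => f x * (h x)^*%R).
Proof. by []. Qed.

(** Expand K_d = sum_j c_j f_j. Pairing f_j with K_d gives f_j(1) by the reproducing property and
    the conjugate of c_j by orthonormality. *)
Lemma repr_kernel_trsum d N (f : 'I_N -> U -> C) (g : U) :
  orthonormal_basis mu (@homog_poly R n d) f ->
  repr_kernel f (oneU R n) g = trsum d g.
Proof.
move=> [Vf of_ sf]; have [q hq qE] := trsum_homog d.
have [c cE] : exists c : 'I_N -> C, forall x, trsum d x = \sum_(j < N) c j * f j x.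
  by apply: sf; exists q.
rewrite cE; apply: eq_bigr => j _; congr (_ * _).
have rf i : bmfun (f i).
  have [p _ /funext ->] := Vf i; exact: bmfun_ev.
have <- : inner_prod mu (f j) (trsum d) = f j (oneU R n).
  have [p hp pE] := Vf j; rewrite pE -(cint_ev_wsum hp) inner_prodE.
  by apply: cint_ext => x; rewrite pE trsum_conj.
rewrite inner_prodE.
transitivity ((\sum_i (c i)^*%R * inner_prod mu (f j) (f i))^*%R).
  have e i : (c i)^*%R * inner_prod mu (f j) (f i) = cint mu (fun x => (c i)^*%R * (f j x * (f i x)^*%R)).
    by rewrite inner_prodE cintZ //; exact: bmfun_mul (rf _) (bmfun_conj (rf _)).
  under eq_bigr do rewrite e.
  rewrite -cint_sum; last first.
    by move=> i; apply: bmfun_mul; [exact: bmfun_cst|exact: bmfun_mul (rf _) (bmfun_conj (rf _))].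
  congr (_^*%R); apply: cint_ext => x; rewrite cE rmorph_sum mulr_sumr; apply: eq_bigr => i _.
  by rewrite rmorphM mulrCA.
rewrite (bigD1 j) //= of_ eqxx mulr1 big1 ?addr0 ?conjCK // => i ij.
by rewrite of_ eq_sym (negbTE ij) mulr0.
Qed.

End Kernel.

(** * Alternants and Schur polynomials *)

Section Newton.
Variables (A : comNzRingType) (x : nat -> A).

(* Coefficients of [t ^+ m] in the Newton basis [\prod_(l < k) (t - x l)]. *)
Fixpoint newton_coef m k : A :=
  if m is m'.+1 then (if k is k'.+1 then newton_coef m' k' else 0) + x k * newton_coef m' k
  else (k == 0%N)%:R.

Lemma newton_coef_small m k : (m < k)%N -> newton_coef m k = 0.
Proof.
elim: m k => [|m IHm] [|k] //= mk.
by rewrite !IHm // ?mulr0 ?addr0 // ltnW.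
Qed.

Lemma newton_coef_diag m : newton_coef m m = 1.
Proof. by elim: m => //= m ->; rewrite newton_coef_small // mulr0 addr0. Qed.

(** Induction on [m] through t N_k = N_(k+1) + x_k N_k. At t = x_i every N_k with k > i vanishes, so
    stopping at [n] is exact. *)
Lemma newton_expansion n i m : (i < n)%N ->
  x i ^+ m = \sum_(k < n) newton_coef m k * \prod_(l < k) (x i - x l).
Proof.
move=> i_n; case: n i_n => // n i_n.
pose N k := \prod_(l < k) (x i - x l).
have NS k : N k.+1 = N k * (x i - x k) by rewrite /N big_ord_recr.
have Nn : N n.+1 = 0.
  by rewrite /N (bigD1 (Ordinal i_n)) //= subrr mul0r.
rewrite -/N; elim: m => [|m IHm].
  rewrite big_ord_recl [X in _ + X]big1 => [|k _]; last by rewrite mul0r.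
  by rewrite addr0 big_ord0 mulr1.
rewrite exprS IHm mulr_sumr.
transitivity (\sum_(k < n.+1) (newton_coef m k * N k.+1 + x k * newton_coef m k * N k)).
  by apply: eq_bigr => k _; rewrite -/(N k) NS; ring.
rewrite big_split /= big_ord_recr /= Nn mulr0 addr0.
under [RHS]eq_bigr do rewrite mulrDl.
rewrite [RHS]big_split /=; congr (_ + _).
by rewrite big_ord_recl /= mul0r add0r; apply: eq_bigr => k _; rewrite /bump add1n.
Qed.

End Newton.

Lemma newton_coef1 (A : comNzRingType) m k : newton_coef (fun _ => 1 : A) m k = 'C(m, k)%:R.
Proof.
elim: m k => [k|m IHm [|k]] /=; first by rewrite bin0n.
  by rewrite IHm !bin0 add0r mul1r.
by rewrite !IHm mul1r -natrD binS addnC.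
Qed.

Lemma rmorph_newton_coef (A B : comNzRingType) (f : {rmorphism A -> B}) x m k :
  f (newton_coef x m k) = newton_coef (f \o x) m k.
Proof.
elim: m k => [|m IHm] k /=; first by rewrite rmorph_nat.
by rewrite rmorphD rmorphM IHm; case: k => [|k]; rewrite ?rmorph0 ?IHm.
Qed.

Definition staircase n := (\sum_(j < n) (n - j.+1))%N.

Section Alternant.
Variables (A : comNzRingType) (n : nat).
Implicit Types (x : 'I_n -> A) (e : nat -> nat).

Definition altdet x e : A := \det (\matrix_(i < n, j < n) x i ^+ (e j + (n - j.+1))).

Definition extend x (k : nat) : A := if insub k is Some i then x i else 0.

Lemma extendE x (i : 'I_n) : extend x i = x i.
Proof. by rewrite /extend valK. Qed.

(** A division-free form of the quotient of alternants ([schurE]). Rows are listed in reverse so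
    that the matrix for e = 0 is unitriangular. *)
Definition newtondet x e : A :=
  \det (\matrix_(k < n, j < n) newton_coef (extend x) (e j + (n - j.+1))%N (n - k.+1)%N).

Lemma newtondet0 x : newtondet x (fun=> 0%N) = 1.
Proof.
rewrite /newtondet det_trig.
  by apply: big1 => i _; rewrite mxE newton_coef_diag.
apply/is_trig_mxP => i j ij; rewrite mxE newton_coef_small //.
by rewrite add0n ltn_sub2l // (leq_ltn_trans _ (ltn_ord j)).
Qed.

(** The matrix of powers is the matrix of Newton basis values, independent of [e], times that of
    Newton coefficients. Taking e = 0 identifies the determinant of the first factor. *)
Lemma altdet_newton x e : altdet x e = newtondet x e * altdet x (fun=> 0%N).
Proof.
pose NM : 'M[A]_n := \matrix_(i, k) \prod_(l < (n - k.+1)%N) (x i - extend x l).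
have h f : altdet x f = \det NM * newtondet x f.
  rewrite -det_mulmx; congr (\det _); apply/matrixP => i j; rewrite !mxE.
  rewrite -(extendE x i) (newton_expansion _ _ (ltn_ord i)) (reindex_inj rev_ord_inj) /=.
  by apply: eq_bigr => k _; rewrite !mxE extendE mulrC.
by rewrite !h newtondet0 mulr1 mulrC.
Qed.

Lemma altdetE x e : altdet x e =
  \sum_(s : 'S_n) (-1) ^+ s * \prod_i x i ^+ (e (s i) + (n - (s i).+1)).
Proof. by apply: eq_bigr => s _; congr (_ * _); apply: eq_bigr => i _; rewrite mxE. Qed.

Lemma coef_prod_ffun (Q : 'I_n -> {poly A}) M D : (D < M)%N ->
  (\prod_i Q i)`_D = \sum_(b : {ffun 'I_n -> 'I_M} | (\sum_i b i == D)%N) \prod_i (Q i)`_(b i).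
Proof.
(* Truncating the factors at [M] changes the product by a multiple of 'X^M only. *)
move=> DM; have [T hT] : exists T, \prod_i Q i = \prod_i take_poly M (Q i) + T * 'X^M.
  elim/big_rec2: _ => [|i p q _ [T ->]]; first by exists 0; rewrite mul0r addr0.
  exists (drop_poly M (Q i) * (p + T * 'X^M) + take_poly M (Q i) * T).
  by rewrite -{1}(poly_take_drop M (Q i)); ring.
rewrite hT coefD coefMXn DM addr0.
have -> : \prod_i take_poly M (Q i) = \prod_i \sum_(k < M) (Q i)`_k *: 'X^k.
  by apply: eq_bigr => i _; rewrite /take_poly poly_def.
rewrite bigA_distr_bigA /= coef_sum [RHS]big_mkcond /=; apply: eq_bigr => b _.
rewrite scaler_prod -(big_morph _ (exprD _) (expr0 _)) coefZ coefXn eq_sym.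
by case: ifP; rewrite ?mulr1 ?mulr0.
Qed.

(* The generating function [\prod_i (1 - x i 'X)^-n], each factor truncated at degree [M]. *)
Definition genpoly M x : {poly A} :=
  \prod_i \poly_(k < M) ('C(k + n.-1, n.-1)%:R * x i ^+ k).

Definition bindet (b : 'I_n -> nat) : A := \det (\matrix_(i < n, j < n) 'C(b i, n - j.+1)%:R).

(** By Vandermonde's convolution the two matrices differ by the unitriangular matrix of binomials
    C(j, k). *)
Lemma bindet_shift (b : 'I_n -> nat) :
  bindet b = \det (\matrix_(i < n, j < n) 'C(b i + j, n.-1)%:R).
Proof.
pose T : 'M[A]_n := \matrix_(k, j) 'C(j, k)%:R.
have detT : \det T = 1.
  rewrite -det_tr det_trig; first by apply: big1 => i _; rewrite !mxE binn.
  by apply/is_trig_mxP => i j ij; rewrite !mxE bin_small.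
rewrite -[LHS]mulr1 -[X in _ * X = _]detT -det_mulmx; congr (\det _); apply/matrixP => i j.
rewrite !mxE addnC -binomial.Vandermonde natr_sum.
have n0 : n = n.-1.+1 by rewrite prednK // (leq_ltn_trans _ (ltn_ord i)).
rewrite -[in RHS]n0; apply: eq_bigr => k _; rewrite !mxE mulrC natrM; congr (_ * 'C(_, _)%:R).
by rewrite -subn1 -subnDA add1n.
Qed.

Lemma altdet_genpoly x M d : (d + staircase n < M)%N ->
  altdet x (fun=> 0%N) * (genpoly M x)`_d =
  \sum_(b : {ffun 'I_n -> 'I_M} | (\sum_i b i == d + staircase n)%N)
     bindet (fun i : 'I_n => b i : nat) * \prod_i x i ^+ b i.
Proof.
move=> DM; pose P i : {poly A} := \poly_(k < M) ('C(k + n.-1, n.-1)%:R * x i ^+ k).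
(* Each monomial of the Vandermonde determinant is absorbed into the factors with a matching power
   of 'X, raising the degree by [staircase n]. The coefficient of degree b in [Q i j] is then C(b +
   j, n - 1) x_i^b. *)
pose Q i (j : nat) : {poly A} := (x i ^+ (n - j.+1)) *: 'X^(n - j.+1) * P i.
transitivity (\sum_(s : 'S_n) (-1) ^+ s * (\prod_i Q i (s i))`_(d + staircase n)).
  rewrite altdetE mulr_suml; apply: eq_bigr => s _; rewrite -mulrA; congr (_ * _).
  rewrite big_split /= scaler_prod -(big_morph _ (exprD _) (expr0 _)).
  have -> : (\sum_i (n - (s i).+1))%N = staircase n.
    by rewrite /staircase [RHS](reindex_inj (@perm_inj _ s)).
  by rewrite -scalerAl coefZ coefXnM ltnNge leq_addl /= addnK.
under eq_bigr do rewrite (coef_prod_ffun _ DM) mulr_sumr.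
rewrite exchange_big; apply: eq_bigr => b _ /=.
rewrite bindet_shift mulr_suml; apply: eq_bigr => s _; rewrite -mulrA; congr (_ * _).
rewrite -big_split; apply: eq_bigr => i _ /=; rewrite mxE.
rewrite /Q -scalerAl coefZ coefXnM coef_poly.
have sn : (n - (s i).+1 = n.-1 - s i)%N by rewrite -subn1 -subnDA add1n.
have sl : (s i <= n.-1)%N by rewrite -ltnS (ltn_predK (ltn_ord (s i))).
(* Below degree n - 1 - s(i) the coefficient is zero, and so is the binomial. *)
case: ltnP => h.
  rewrite mulr0 bin_small ?mul0r //.
  by rewrite -(subnK sl) ltn_add2r -sn.
rewrite (leq_ltn_trans (leq_subr _ _) (ltn_ord _)) mulrCA -exprD subnKC //; congr ('C(_, _)%:R * _).
by rewrite -{1}(subnK sl) -sn addnA subnK.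
Qed.

End Alternant.

(** * Exponent vectors as permuted shifted partitions *)

Section PartitionExponents.
Variables (n d : nat).
Implicit Type lam : intpart d.

Lemma part_gt0 lam j : (0 < part lam j)%N = (j < plength lam)%N.
Proof.
rewrite /part /plength; move: (parts_sorted lam); elim: (parts lam) j => [|x s IHs] j xs /=.
  by rewrite nth_nil.
case: x xs => [|x] xs.
  have s0 i : i \in s -> i = 0%N.
    by move/(allP (order_path_min geq_trans xs)); rewrite /= leqn0 => /eqP.
  rewrite (@eq_in_count _ _ pred0) ?count_pred0 // => [|i si]; last by rewrite (s0 i si).
  case: j => //= j; have [js|js] := ltnP j (size s); last by rewrite nth_default.
  by rewrite (s0 _ (mem_nth _ js)).
by case: j => //= j; rewrite IHs ?(path_sorted xs).
Qed.

Lemma part_eq0 lam j : (plength lam <= n)%N -> (n <= j)%N -> part lam j = 0%N.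
Proof.
by move=> ln nj; apply/eqP; rewrite -leqn0 leqNgt part_gt0 -leqNgt (leq_trans ln).
Qed.

Lemma part_mono lam i j : (i <= j)%N -> (part lam j <= part lam i)%N.
Proof.
move=> ij; have [jd|dj] := ltnP j (size (parts lam)); last by rewrite /part [nth _ _ j]nth_default.
apply: (sorted_leq_nth geq_trans leqnn 0%N (parts_sorted lam)) => //.
by rewrite inE (leq_ltn_trans ij).
Qed.

Lemma sum_part lam : (plength lam <= n)%N -> (\sum_(j < n) part lam j)%N = d.
Proof.
move=> ln; have nth_sum (s : seq nat) k : (\sum_(j < size s + k) nth 0%N s j)%N = sumn s.
  rewrite big_split_ord /= [X in (_ + X)%N]big1 ?addn0 => [|i _]; last first.
    by rewrite nth_default // leq_addr.
  by rewrite sumnE (big_nth 0%N) big_mkord.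
rewrite -[RHS](sumn_parts lam) -(nth_sum _ n) addnC big_split_ord /=.
rewrite [X in (_ + X)%N]big1 ?addn0 // => i _.
by rewrite -/(part lam _) part_eq0 // leq_addr.
Qed.

Definition expon lam (j : nat) := (part lam j + (n - j.+1))%N.

Lemma expon_lt lam i j : (i < j < n)%N -> (expon lam j < expon lam i)%N.
Proof.
move=> /andP [ij jn]; rewrite /expon -addnS leq_add ?part_mono ?(ltnW ij) //.
by rewrite ltn_sub2l // (leq_ltn_trans ij).
Qed.

Lemma expon_inj lam : injective (fun j : 'I_n => expon lam j).
Proof.
move=> i j; case: (ltngtP i j) => [ij|ji|/val_inj //] e.
  by have := expon_lt lam (i := i) (j := j); rewrite ij ltn_ord e ltnn => /(_ isT).
by have := expon_lt lam (i := j) (j := i); rewrite ji ltn_ord e ltnn => /(_ isT).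
Qed.

Lemma sum_expon lam : (plength lam <= n)%N -> (\sum_(j < n) expon lam j = d + staircase n)%N.
Proof. by move=> ln; rewrite big_split /= sum_part. Qed.

Local Notation D := (d + staircase n)%N.

Lemma expon_le lam (j : 'I_n) : (plength lam <= n)%N -> (expon lam j < D.+1)%N.
Proof. by move=> ln; rewrite ltnS -(sum_expon ln) (bigD1 j) //= leq_addr. Qed.

(** On partitions with at most [n] parts this is a bijection onto the injective exponent vectors of
    total degree [D]. *)
Definition expon_fun (ls : intpart d * 'S_n) : {ffun 'I_n -> 'I_D.+1} :=
  [ffun i : 'I_n => inord (expon ls.1 (ls.2 i))].

Lemma expon_funE ls i : (plength ls.1 <= n)%N -> expon_fun ls i = expon ls.1 (ls.2 i) :> nat.
Proof. by move=> ln; rewrite ffunE inordK // expon_le. Qed.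

Lemma expon_sorted lam : sorted gtn (mkseq (expon lam) n).
Proof.
apply/(sortedP 0%N) => i; rewrite size_mkseq => i1n.
by rewrite !nth_mkseq ?(ltnW i1n) //; apply: expon_lt; rewrite ltnSn.
Qed.

Lemma gtn_trans : transitive gtn.
Proof. by move=> a b c /= h1 h2; exact: ltn_trans h2 h1. Qed.

Lemma gtn_anti : antisymmetric gtn.
Proof. by move=> x y /= /andP [h1 h2]; have := ltn_trans h1 h2; rewrite ltnn. Qed.

Lemma perm_expon lam (s : 'S_n) :
  perm_eq [seq expon lam (s j) | j <- enum 'I_n] (mkseq (expon lam) n).
Proof.
rewrite /mkseq -val_enum_ord -map_comp (map_comp (fun j : 'I_n => expon lam (val j)) s) perm_map //.
apply: uniq_perm; first by rewrite (map_inj_uniq (@perm_inj _ s)) enum_uniq.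
  exact: enum_uniq.
move=> i; rewrite mem_enum; apply/mapP; exists ((s^-1)%g i); rewrite ?mem_enum //.
by rewrite permKV.
Qed.

Lemma expon_fun_inj : {in [pred ls : intpart d * 'S_n | (plength ls.1 <= n)%N] &, injective expon_fun}.
Proof.
move=> [l1 s1] [l2 s2]; rewrite !inE /= => ln1 ln2 e.
have e' i : expon l1 (s1 i) = expon l2 (s2 i).
  by rewrite -(expon_funE (ls := (l1, s1)) i) // e expon_funE.
have lE : mkseq (expon l1) n = mkseq (expon l2) n.
  apply: (sorted_eq gtn_trans gtn_anti); try exact: expon_sorted.
  rewrite -(permPl (perm_expon l1 s1)) -(permPr (perm_expon l2 s2)).
  by rewrite (eq_map (g := fun j => expon l2 (s2 j))).
have l12 : l1 = l2.
  apply: parts_inj; apply: (@eq_from_nth _ 0%N); first by rewrite !size_parts.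
  move=> j _; rewrite -![nth _ _ _]/(part _ _).
  have [jn|nj] := ltnP j n; last by rewrite !part_eq0.
  have := congr1 (nth 0%N ^~ j) lE; rewrite !nth_mkseq //.
  exact: addIn.
rewrite l12 in e' *; congr (_, _); apply/permP => i.
exact: (@expon_inj l2) (e' i).
Qed.

(** Sort the distinct exponents decreasingly and subtract the staircase; the permutation records
    their original positions. *)
Lemma expon_fun_surj (b : {ffun 'I_n -> 'I_D.+1}) : injective b -> (\sum_i b i = D)%N ->
  exists ls, (plength ls.1 <= n)%N /\ b = expon_fun ls.
Proof.
move=> ib sb; pose s0 := [seq val (b i) | i <- enum 'I_n].
pose s := sort geq s0.
have us0 : uniq s0 by rewrite map_inj_uniq ?enum_uniq // => i j /val_inj /ib.
have ps : perm_eq s s0 by rewrite perm_sort.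
have us : uniq s by rewrite (perm_uniq ps).
have zs : size s = n by rewrite (perm_size ps) size_map size_enum_ord.
have ss : sorted geq s by apply: sort_sorted => x y; rewrite orbC leq_total.
have lt_s i : (i.+1 < n)%N -> (nth 0%N s i.+1 < nth 0%N s i)%N.
  move=> i1n; rewrite ltn_neqAle; apply/andP; split.
    by rewrite nth_uniq ?zs ?(ltnW i1n) // gtn_eqF.
  by move/(sortedP 0%N): ss; apply; rewrite zs.
(* Counted from the end, a strictly decreasing list of naturals dominates 0, 1, 2, ..., so
   subtracting the staircase never truncates. *)
have le_s k : (k < n)%N -> (k <= nth 0%N s (n - k.+1))%N.
  elim: k => // k IHk k1n; apply: (leq_ltn_trans (IHk (ltnW k1n))).
  have e : (n - k.+1 = (n - k.+2).+1)%N by rewrite -subnSK.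
  by rewrite e; apply: lt_s; lia.
have ge_s (j : nat) : (j < n)%N -> (n - j.+1 <= nth 0%N s j)%N.
  move=> jn; have := le_s (n - j.+1)%N; rewrite (_ : n - (n - j.+1).+1 = j)%N; last by lia.
  by apply; lia.
pose l := mkseq (fun j => (nth 0%N s j - (n - j.+1))%N) n.
have sl : sorted geq l.
  apply/(sortedP 0%N) => i; rewrite size_mkseq => i1n; rewrite !nth_mkseq ?(ltnW i1n) //=.
  by have := lt_s i i1n; lia.
have lE j : (j < n)%N -> (nth 0%N l j + (n - j.+1) = nth 0%N s j)%N.
  by move=> jn; rewrite nth_mkseq // subnK // ge_s.
have suml : sumn l = d.
  have e1 : (sumn l + staircase n = sumn s)%N.
    have sn t : size t = n -> sumn t = (\sum_(j < n) nth 0%N t j)%N.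
      by move=> <-; rewrite sumnE (big_nth 0%N) big_mkord.
    rewrite (sn s) // (sn l) ?size_mkseq // -big_split /=.
    by apply: eq_bigr => j _; exact: lE.
  apply: (@addIn (staircase n)); rewrite e1 (perm_sumn ps) -[RHS]sb sumnE big_map big_enum.
  exact: eq_bigr.
have [lam lamE] := intpart_exists sl suml.
have partE j : part lam j = nth 0%N l j.
  rewrite /part lamE nth_cat size_take_min; case: ltnP => jl.
    by rewrite nth_take // (leq_trans jl) // geq_minl.
  rewrite nth_nseq if_same; have [lj|lj] := leqP (size l) j; first by rewrite nth_default.
  have dj : (d <= j)%N by move: jl; rewrite geq_min [(size l <= j)%N]leqNgt lj orbF.
  have h := sorted_geq_drop sl; rewrite suml in h.
  have jm : nth 0%N (drop d l) (j - d) \in drop d l by rewrite mem_nth // size_drop ltn_sub2r // (leq_ltn_trans dj).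
  by have /eqP := allP h _ jm; rewrite nth_drop subnKC.
have ln : (plength lam <= n)%N.
  by rewrite leqNgt -part_gt0 partE nth_default // size_mkseq.
have exponE j : (j < n)%N -> expon lam j = nth 0%N s j by move=> jn; rewrite /expon partE lE.
have bs i : val (b i) \in s by rewrite (perm_mem ps); apply/mapP; exists i; rewrite ?mem_enum.
have idx i : (index (val (b i)) s < n)%N.
  by rewrite -[X in (_ < X)%N]zs index_mem.
pose f i := Ordinal (idx i).
have fi : injective f.
  move=> i j /(congr1 val) /= e; apply: ib; apply: val_inj.
  have := nth_index 0%N (bs i); rewrite e => <-.
  exact: (nth_index 0%N (bs j)).
exists (lam, perm fi); split=> //; apply/ffunP => i; apply: ord_inj.
rewrite expon_funE // permE exponE; last exact: ltn_ord.
by rewrite [RHS](nth_index 0%N (bs i)).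
Qed.

Variable A : comNzRingType.

Lemma bindet_perm (e : 'I_n -> nat) (s : 'S_n) :
  bindet A (fun i : 'I_n => e (s i)) = (-1) ^+ s * bindet A e.
Proof.
rewrite /bindet -det_perm -det_mulmx -row_permE; congr (\det _).
by apply/matrixP => i j; rewrite !mxE.
Qed.

Lemma bindet_not_inj (e : 'I_n -> nat) : ~~ injectiveb e -> bindet A e = 0.
Proof.
case/injectivePn => i [j ij eij].
by apply: (determinant_alternate ij) => k; rewrite !mxE eij.
Qed.

(** A repeated exponent gives [bindet] two equal rows. The other vectors are permuted shifted
    partitions, and the signs of the permutations assemble the alternants. *)
Lemma sum_exponents (x : 'I_n -> A) :
  \sum_(b : {ffun 'I_n -> 'I_D.+1} | (\sum_i b i == D)%N)
     bindet A (fun i : 'I_n => b i : nat) * \prod_i x i ^+ b i =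
  \sum_(lam : intpart d | (plength lam <= n)%N)
     bindet A (fun i : 'I_n => expon lam i) * altdet x (part lam).
Proof.
pose G (b : {ffun 'I_n -> 'I_D.+1}) := bindet A (fun i : 'I_n => b i : nat) * \prod_i x i ^+ b i.
pose P := [pred ls : intpart d * 'S_n | (plength ls.1 <= n)%N].
transitivity (\sum_(b in [set expon_fun ls | ls in P]) G b); last first.
  rewrite big_imset; last exact: expon_fun_inj.
  under [RHS]eq_bigr do rewrite altdetE mulr_sumr.
  rewrite pair_big_dep /=; apply: eq_big => [ls|ls]; first by rewrite inE andbT.
  rewrite inE => ln; rewrite /G.
  have -> : bindet A (fun i : 'I_n => expon_fun ls i) = (-1) ^+ ls.2 * bindet A (fun i : 'I_n => expon ls.1 i).
    rewrite -bindet_perm; congr (bindet _ _); apply/funext => i; exact: expon_funE.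
  rewrite [RHS]mulrCA [RHS]mulrA; congr (_ * _ * _).
  by apply: eq_bigr => i _; rewrite expon_funE.
rewrite [LHS]big_mkcond [RHS]big_mkcond /=; apply: eq_bigr => b _.
have [ib|nib] := boolP (injectiveb (fun i => b i : nat)); last first.
  by rewrite /G bindet_not_inj // mul0r !if_same.
have -> : (\sum_i b i == D)%N = (b \in [set expon_fun ls | ls in P]); last by [].
apply/eqP/imsetP => [sb|[ls lsP ->]].
  have [|ls [ln ->]] := expon_fun_surj _ sb; last by exists ls.
  by move=> i j /(congr1 val); exact: (injectiveP _ ib).
rewrite inE in lsP; rewrite -[RHS](sum_expon lsP) [RHS](reindex_inj (@perm_inj _ ls.2)).
by apply: eq_bigr => i _; exact: expon_funE.
Qed.

End PartitionExponents.

(** * The generating function of the kernels *)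

Section GeneratingFunction.

(** The coefficient form of X G' = n X / (1 - X) G for G = (1 - X)^-n. *)
Lemma hockey_stick n k : (0 < n)%N ->
  (k * 'C(k + n.-1, n.-1) = n * \sum_(l < k) 'C(l + n.-1, n.-1))%N.
Proof.
case: n => // m _ /=; elim: k => [|k IHk]; first by rewrite big_ord0 muln0.
rewrite big_ord_recr mulnDr /= -IHk -mulnDl.
have e1 : 'C(k.+1 + m, m) = 'C((k + m).+1, k.+1).
  by rewrite -(@bin_sub (k.+1 + m) m) ?leq_addl // addnK.
have e2 : 'C(k + m, m) = 'C(k + m, k) by rewrite -(@bin_sub (k + m) m) ?leq_addl // addnK.
by rewrite e1 e2 -mul_bin_diag /= addnS.
Qed.

Variable F : numFieldType.

Lemma logder_coefs D (G L : {poly F}) :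
  (forall k, (k <= D)%N -> k%:R * G`_k = (L * G)`_k) -> logder D G L.
Proof.
move=> h; pose p := 'X * G^`() - L * G.
have p0 : take_poly D.+1 p = 0.
  apply/polyP => k; rewrite coef0 coef_take_poly ltnS; case: leqP => // kD.
  rewrite coefB -h // coefXM coef_deriv.
  by case: k kD => [|k] _; rewrite ?mul0r ?subrr //= mulr_natl subrr.
exists (drop_poly D.+1 p); have := poly_take_drop D.+1 p; rewrite p0 add0r mulrC => ->.
by rewrite addrC subrK.
Qed.

(** Both sides start at 1 and obey the same recurrence, since the logarithmic derivative of the
    generating function is n sum_i sum_r x_i^r X^r. *)
Lemma genpoly_psum n (x : 'I_n -> F) D d : (d <= D)%N ->
  (genpoly D.+1 x)`_d = psum (fun k => n%:R * \sum_i x i ^+ k) d.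
Proof.
pose L i := \sum_(r < D) (n%:R * x i ^+ r.+1) *: 'X^(r.+1) : {poly F}.
have Lcoef i k : (k < D)%N -> (L i)`_k.+1 = n%:R * x i ^+ k.+1.
  move=> kD; rewrite /L coef_sum (bigD1 (Ordinal kD)) //= coefZ coefXn eqxx mulr1.
  rewrite big1 ?addr0 // => j jk; rewrite coefZ coefXn eqSS [_ == _]eq_sym.
  by rewrite [_ == _](negbTE jk) mulr0.
have L0 i : (L i)`_0 = 0 by rewrite coef_sum big1 // => r _; rewrite coefZ coefXn mulr0.
have h : logder D (genpoly D.+1 x) (\sum_i L i).
  apply: logder_prod => i _; apply: logder_coefs => k kD.
  rewrite coef_poly ltnS kD coefM big_ord_recl L0 mul0r add0r.
  rewrite mulrA -natrM hockey_stick ?(leq_ltn_trans _ (ltn_ord i)) // natrM natr_sum mulr_sumr mulr_suml.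
  rewrite [LHS](reindex_inj rev_ord_inj) /=; apply: eq_bigr => j _.
  rewrite /bump /= add1n Lcoef ?(leq_trans (ltn_ord j)) // coef_poly.
  have -> : (k - j.+1 < D.+1)%N by rewrite ltnS (leq_trans (leq_subr _ _)).
  by rewrite -[X in _ * x i ^+ X = _](subnKC (ltn_ord j)) exprD; ring.
elim/ltn_ind: d => -[|d] IHd dD.
  rewrite psum0 /genpoly coef0_prod big1 // => i _.
  by rewrite coef_poly /= add0n binn expr0 mulr1.
apply: (@mulfI _ d.+1%:R); first by rewrite pnatr_eq0.
rewrite (logder_coef h dD) psum_rec big_ord_recl coef_sum big1 ?mul0r ?add0r //.
apply: eq_bigr => k _. rewrite lift0 subSS IHd ?ltnS ?leq_subr //; last first.
  by rewrite (leq_trans (leq_subr _ _)) // ltnW.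
congr (_ * _); rewrite coef_sum mulr_sumr; apply: eq_bigr => i _.
by rewrite Lcoef // (leq_trans (ltn_ord k)).
Qed.

End GeneratingFunction.

(** * Schur polynomials and the Cauchy identity *)

Section SchurEvaluation.
Variables (R : realType) (n : nat).
Local Notation C := R[i].
Local Notation mpol := (mpoly.mpoly n C).
Local Notation var := (fun i : 'I_n => mpoly.mpolyX C (mpoly.mnm1 i) : mpol).
Local Notation meval := (@mpoly.meval n C).

Lemma newton_coef_eq (A : comNzRingType) (x y : nat -> A) m k :
  (forall l, (l <= k)%N -> x l = y l) -> newton_coef x m k = newton_coef y m k.
Proof.
elim: m k => //= m IHm k xy; rewrite xy // (IHm k) //; congr (_ + _).
by case: k xy => // k xy; apply: IHm => l lk; apply: xy; exact: leqW.
Qed.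

Lemma rmorph_newtondet (A B : comNzRingType) (f : {rmorphism A -> B}) (x : 'I_n -> A) e :
  f (newtondet x e) = newtondet (f \o x) e.
Proof.
rewrite /newtondet -det_map_mx; congr (\det _); apply/matrixP => i j; rewrite !mxE.
rewrite rmorph_newton_coef; apply: newton_coef_eq => l _ /=.
by rewrite /extend; case: insub => //=; rewrite rmorph0.
Qed.

Lemma newtondet1 (A : comNzRingType) d (lam : intpart d) :
  newtondet (fun _ : 'I_n => 1) (part lam) = bindet A (fun i : 'I_n => expon n lam i).
Proof.
rewrite /newtondet /bindet -det_tr; congr (\det _); apply/matrixP => i j; rewrite !mxE.
rewrite -newton_coef1; apply: newton_coef_eq => l lj.
by rewrite /extend insubT //; have := ltn_ord j; lia.
Qed.

Lemma rmorph_genpoly (A B : comNzRingType) (f : {rmorphism A -> B}) M (x : 'I_n -> A) d :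
  f (genpoly M x)`_d = (genpoly M (f \o x))`_d.
Proof.
rewrite -coef_map (_ : map_poly f (genpoly M x) = genpoly M (f \o x)) //.
rewrite /genpoly rmorph_prod; apply: eq_bigr => i _; apply/polyP => k.
rewrite coef_map !coef_poly; case: ifP => _; last exact: rmorph0.
by rewrite -[LHS]/(f _) rmorphM rmorphXn rmorph_nat.
Qed.

Lemma rmorph_bindet (A B : comNzRingType) (f : {rmorphism A -> B}) (b : 'I_n -> nat) :
  f (bindet A b) = bindet B b.
Proof.
rewrite /bindet -det_map_mx; congr (\det _); apply/matrixP => i j; by rewrite !mxE rmorph_nat.
Qed.

Lemma rmorph_altdet (A B : comNzRingType) (f : {rmorphism A -> B}) (x : 'I_n -> A) e :
  f (altdet x e) = altdet (f \o x) e.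
Proof.
rewrite /altdet -det_map_mx; congr (\det _); apply/matrixP => i j; by rewrite !mxE rmorphXn.
Qed.

(** Evaluation at the distinct points 0, ..., n - 1 gives a nonzero Vandermonde determinant up to
    sign. *)
Lemma altdet0_neq0 : altdet var (fun=> 0%N) != 0.
Proof.
pose v (i : 'I_n) : C := i%:R.
suff : altdet v (fun=> 0%N) != 0.
  apply: contra_neq => /(congr1 (meval v)); rewrite (rmorph_altdet (mpoly.meval v)) rmorph0 => h.
  by rewrite -[RHS]h; congr (altdet _ _); apply/funext => i /=; rewrite mpoly.mevalXU.
have -> : altdet v (fun=> 0%N) = \det (row_perm (perm rev_ord_inj) (Vandermonde n (\row_i v i))).
  rewrite /altdet -det_tr; congr (\det _); apply/matrixP => i j.
  by rewrite !mxE permE add0n.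
rewrite row_permE det_mulmx det_perm mulf_neq0 ?signr_eq0 // det_Vandermonde.
apply/prodf_neq0 => i _; apply/prodf_neq0 => j ij.
by rewrite !mxE subr_eq0 /v eqr_nat eq_sym neq_ltn ij.
Qed.

Lemma schurE d (lam : intpart d) : schur R n lam = newtondet var (part lam).
Proof.
have altE e : alternant R n e = altdet var e by [].
apply: xget_unique => /=; first by rewrite !altE -(altdet_newton _ (part lam)).
move=> s; rewrite !altE (altdet_newton _ (part lam)) => /(mulIf altdet0_neq0); exact.
Qed.

Lemma schur_evalE d (lam : intpart d) (x : 'I_n -> C) : schur_eval lam x = newtondet x (part lam).
Proof.
rewrite /schur_eval schurE (rmorph_newtondet (mpoly.meval x)); congr (newtondet _ _).
by apply/funext => i /=; rewrite mpoly.mevalXU.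
Qed.

Lemma cauchy_identity d (x : 'I_n -> C) :
  psum (fun k => n%:R * \sum_i x i ^+ k) d =
  \sum_(lam : intpart d | (plength lam <= n)%N) schur_eval lam (fun _ : 'I_n => 1) * schur_eval lam x.
Proof.
rewrite -(@genpoly_psum _ _ _ (d + staircase n)%N) ?leq_addr //.
have aux (a b c e : mpol) : e = c * a -> b * e = a * (b * c).
  by move=> ->; rewrite mulrA [RHS]mulrC.
(* The identity is proved for indeterminates, where the Vandermonde determinant can be cancelled,
   and then evaluated at [x], whose coordinates may coincide. *)
have h : (genpoly (d + staircase n).+1 var)`_d = \sum_(lam : intpart d | (plength lam <= n)%N)
    bindet mpol (fun i : 'I_n => expon n lam i) * newtondet var (part lam).
  have e1 := @altdet_genpoly mpol n var (d + staircase n).+1 d (ltnSn _).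
  have e2 := @sum_exponents n d mpol var.
  apply: (mulfI altdet0_neq0).
  have e3 := etrans e1 e2.
  apply: (etrans e3).
  rewrite [RHS]mulr_sumr.
  by apply: eq_bigr => lam _; exact: aux (altdet_newton var (part lam)).
have := congr1 (mpoly.meval x) h.
rewrite (rmorph_genpoly (mpoly.meval x)) rmorph_sum.
have -> : meval x \o var = x by apply/funext => i /=; rewrite mpoly.mevalXU.
move=> ->; apply: eq_bigr => lam _ /=.
apply: (etrans (rmorphM (mpoly.meval x) _ _)); congr (_ * _).
  apply: (etrans (rmorph_bindet (mpoly.meval x) _)).
  by rewrite schur_evalE newtondet1.
apply: (etrans (rmorph_newtondet (mpoly.meval x) var (part lam))).
rewrite schur_evalE; congr (newtondet _ _).
by apply/funext => i /=; rewrite mpoly.mevalXU.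
Qed.

End SchurEvaluation.

(** * Power sums of eigenvalues *)

Section Eigenvalues.
Variables (R : realType) (n : nat).
Local Notation C := R[i].
Implicit Type M : 'M[C]_n.

Lemma char_poly_conj (P : 'M[C]_n) M : P \in unitmx ->
  char_poly (invmx P *m M *m P) = char_poly M.
Proof.
move=> Pu; rewrite /char_poly.
have -> : char_poly_mx (invmx P *m M *m P) =
    map_mx polyC (invmx P) *m char_poly_mx M *m map_mx polyC P.
  rewrite /char_poly_mx mulmxBr mulmxBl -!map_mxM; congr (_ - _).
  by rewrite mul_mx_scalar -scalemxAl -map_mxM mulVmx // map_mx1 scalemx1.
rewrite !det_mulmx mulrAC -det_mulmx -map_mxM mulVmx // map_mx1 det1 mul1r //.
Qed.

Lemma conj_expmx (P D : 'M[C]_n) k : P \in unitmx ->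
  (invmx P *m D *m P) ^+ k = invmx P *m D ^+ k *m P.
Proof.
move=> Pu; elim: k => [|k IHk]; first by rewrite !expr0 mulmx1 mulVmx.
rewrite exprS IHk exprS -[D * _]/(D *m _) -[LHS]/(_ *m _).
by rewrite !mulmxA mulmxK.
Qed.

Lemma diag_mx_exp (v : 'rV[C]_n) k : diag_mx v ^+ k = diag_mx (\row_i v 0 i ^+ k).
Proof.
elim: k => [|k IHk].
  rewrite expr0 (_ : \row_i _ = const_mx 1) ?diag_const_mx //.
  by apply/rowP => i; rewrite !mxE expr0.
rewrite exprS IHk -[LHS]/(_ *m _) mulmx_diag; congr diag_mx.
by apply/rowP => i; rewrite !mxE exprS.
Qed.

(** Conjugation preserves the characteristic polynomial, so [eigs M] is a permutation of the
    diagonal [v]. *)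
Lemma eigs_power_sum_diagonalizable M (P : 'M[C]_n) (v : 'rV[C]_n) k : P \in unitmx ->
  M = invmx P *m diag_mx v *m P -> \sum_i eigs M i ^+ k = \tr (M ^+ k).
Proof.
move=> Pu ME.
rewrite [in RHS]ME conj_expmx // diag_mx_exp mxtrace_mulC mulmxA mulmxV // mul1mx mxtrace_diag.
rewrite /eigs; case: closed_field_poly_normal => r /=.
rewrite (monicP (char_poly_monic M)) scale1r ME char_poly_conj // char_poly_trig ?diag_mx_is_trig //.
move=> rE; have szr : size r = n.
  have := congr1 (fun p : {poly C} => size p) rE; rewrite !size_prod_XsubC.
  by rewrite -[index_enum _]enumT size_enum_ord => -[].
have rE' : \prod_(z <- r) ('X - z%:P) = \prod_(z <- [seq v 0 i | i <- enum 'I_n]) ('X - z%:P).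
  by rewrite -rE big_map big_enum; apply: eq_bigr => i _; rewrite mxE eqxx mulr1n.
have pe := prod_XsubC_eq rE'.
transitivity (\sum_(z <- r) z ^+ k).
  by rewrite (big_nth 0) szr big_mkord.
rewrite (perm_big _ pe) big_map big_enum; apply: eq_bigr => i _; by rewrite mxE.
Qed.

Lemma eigs_power_sum M k : M \is unitarymx -> \sum_i eigs M i ^+ k = \tr (M ^+ k).
Proof.
move=> uM; apply: (eigs_power_sum_diagonalizable _ (spectral_unit M)).
apply/orthomx_spectralP/normalmxP; have /unitarymxP MM := uM; rewrite MM.
by apply/esym/mulmx1C.
Qed.

Lemma eigs1 i : eigs (1%:M : 'M[C]_n) i = 1.
Proof.
rewrite /eigs; case: closed_field_poly_normal => r /=.
rewrite (monicP (char_poly_monic _)) scale1r char_poly_trig; last first.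
  by apply/is_trig_mxP => a b ab; rewrite mxE -val_eqE ltn_eqF.
move=> rE; have szr : size r = n.
  have := congr1 (fun p : {poly C} => size p) rE; rewrite !size_prod_XsubC.
  by rewrite -[index_enum _]enumT size_enum_ord => -[].
have ri : r`_i \in r by rewrite mem_nth // szr.
have : root (\prod_(i < n) ('X - ((1%:M : 'M[C]_n) i i)%:P)) r`_i by rewrite rE root_prod_XsubC.
rewrite rootE horner_prod => /prodf_eq0 [j _].
by rewrite hornerXsubC mxE eqxx subr_eq0 => /eqP.
Qed.

End Eigenvalues.

Theorem theorem2p22 (R : realType) (n d : nat)
    (haar : probability (borelU R n) R) (haarP : is_haar haar)
    (N : nat) (f : 'I_N -> unitary_group R n -> R[i])
    (fP : orthonormal_basis haar (@homog_poly R n d) f)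
    (g : unitary_group R n) :
  [/\ repr_kernel f 1%g g =
        \sum_(mu : intpart d)
          n%:R ^+ plength mu / (zpart mu)%:R *
          \prod_(j < plength mu) \tr (mxU g ^+ part mu j),
      forall S : intpart d -> irr_unitary_rep R n,
        (forall lam, (plength lam <= n)%N ->
           forall h, rep_char (S lam) h = schur_eval lam (eigs (mxU h))) ->
        repr_kernel f 1%g g =
          \sum_(lam : intpart d | (plength lam <= n)%N)
            (rep_dim (S lam))%:R * rep_char (S lam) g &
      repr_kernel f 1%g g =
        \sum_(lam : intpart d | (plength lam <= n)%N)
          schur_eval lam (fun _ : 'I_n => 1) * schur_eval lam (eigs (mxU g))].
Proof.
have kE := repr_kernel_trsum haarP g fP.
have kS : repr_kernel f 1%g g = \sum_(lam : intpart d | (plength lam <= n)%N)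
    schur_eval lam (fun _ : 'I_n => 1) * schur_eval lam (eigs (mxU g)).
  rewrite -cauchy_identity [LHS]kE /trsum; congr (psum _ _).
  by apply/funext => k; rewrite eigs_power_sum ?mxU_unitary.
split=> //.
- rewrite [LHS]kE /trsum /psum; apply: eq_bigr => mu _.
  by rewrite big_split /= prodr_const card_ord mulrAC.
- move=> S SE; rewrite kS; apply: eq_bigr => lam ln; rewrite SE //; congr (_ * _).
  (* The dimension is the character at the identity, whose eigenvalues are all 1. *)
  rewrite (_ : (rep_dim (S lam))%:R = rep_char (S lam) 1%g); last first.
    by rewrite /rep_char rep_one mxtrace1.
  by rewrite SE //; congr (schur_eval _ _); apply/funext => i; rewrite [RHS]eigs1.
Qed.
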